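(* Let $p>2$ be a prime, $\mathbf{k}=\mathbf{F}_p(x_{11},x_{12},x_{13},x_{21},x_{22},x_{23})$ (rational functions in six indeterminates), and let $V_3$ be the generic three-dimensional representation over $\mathbf{k}$ of $G=(\mathbf{Z}/p)^3=\langle e_1,e_2,e_3\rangle$, so that $G$ acts on $\mathbf{k}[V_3]=\mathbf{k}[x,y,z]$ by algebra automorphisms with $x\cdot e_i=x$, $y\cdot e_i=y+x_{1i}x$, $z\cdot e_i=z+2x_{1i}y+(x_{1i}^2+x_{2i})x$ for $i=1,2,3$. Let $\gamma_{ijk}$, $f_1,f_2,f_3$ and $N_G(z)$ be as defined in the context. Then $\mathcal{B}=\{x,f_1,f_2,f_3,N_G(z)\}$ is a SAGBI basis for $\mathbf{k}[V_3]^G$ with respect to the graded reverse lexicographic order with $x<y<z$. Furthermore, there are two relations among the generators, one constructed by subducting $f_3^p+\gamma_{135}^p\gamma_{123}^{p^2-2p-1}f_1f_2^p$ and the other given by $$f_1^p+\gamma_{123}^{p-2}f_2^2+2(-\gamma_{123})^{(p-3)/2}\gamma_{125}x^{p^2-p}f_1^{(p+1)/2}+2x^{p^2-2}f_3=0.$$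
   Context: Let $\delta=y^2-xz$. Let $\Gamma$ be the matrix whose rows $1,\ldots,5$ are $(x_{11},x_{12},x_{13})$, $(x_{21},x_{22},x_{23})$, $(x_{11}^p,x_{12}^p,x_{13}^p)$, $(x_{21}^p,x_{22}^p,x_{23}^p)$, $(x_{11}^{p^2},x_{12}^{p^2},x_{13}^{p^2})$, and let $\gamma_{ijk}$ be the $3\times3$ minor of $\Gamma$ on rows $i<j<k$. Define $$f_1=-\gamma_{123}\delta^p-\gamma_{124}x^py^p-\gamma_{134}\delta x^{2p-2}-\gamma_{234}yx^{2p-1},$$ $$f_2=\gamma_{123}y^{p^2}-\gamma_{125}y^px^{p^2-p}-\gamma_{135}\delta x^{p^2-2}-\gamma_{235}yx^{p^2-1},$$ $$f_3=\frac{f_1^p+\gamma_{123}^{p-2}f_2^2+2(-\gamma_{123})^{(p-3)/2}\gamma_{125}x^{p^2-p}f_1^{(p+1)/2}}{-2x^{p^2-2}},$$ where $f_3$ is a polynomial; all three are $G$-invariant. $N_G(z)$ is the product of the elements of the $G$-orbit of $z$. A subset $\mathcal{B}$ of a subalgebra $A$ of a polynomial ring is a SAGBI basis for $A$ if the lead monomials of the elements of $\mathcal{B}$ generate, as an algebra, the lead term algebra of $A$ (the algebra spanned by the lead monomials of nonzero elements of $A$); then $\mathcal{B}$ generates $A$. To subduct a polynomial $F$ over $\mathcal{B}$ is to repeatedly subtract from it scalar multiples of products of elements of $\mathcal{B}$ having the same lead term as the current polynomial; for a SAGBI basis, every $F\in A$ subducts to $0$. If $F$ is a polynomial expression in elements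 of $\mathcal{B}$, its subduction to $0$ yields an identity $F-\sum_I c_I\,b^I=0$ with products $b^I$ of elements of $\mathcal{B}$: this is the relation constructed by subducting $F$. ''There are two relations'' means that the ideal of all algebraic relations among the listed generators is generated by those two relations. *)

(* Defs.v *)
From mathcomp Require Import all_boot all_order all_algebra.
From mathcomp Require Import mpoly ring.

Set Implicit Arguments.
Unset Strict Implicit.
Unset Printing Implicit Defensive.

Import Order.TTheory GRing.Theory.

Local Open Scope ring_scope.

(* Here 'X_0 < 'X_1 < ... : in equal degrees, the larger monomial is the one
   with the smaller exponent at the first (i.e. smallest) variable at which
   the two differ.  The order that mpoly.v puts on 'X_{1..n}, and hence its
   [mlead], is the graded lexicographic one with 'X_0 > 'X_1 > ..., so it
   cannot be used; see [grevlexE] for the relation between the two. *)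
Definition grevlex n (m1 m2 : 'X_{1..n}) : bool :=
  [|| m1 == m2, (mdeg m1 < mdeg m2)%N
    | (mdeg m1 == mdeg m2) &&
      [exists i : 'I_n, (m2 i < m1 i)%N &&
         [forall j : 'I_n, (j < i)%N ==> (m1 j == m2 j)]]].

Lemma grevlexE n (m1 m2 : 'X_{1..n}) :
  grevlex m1 m2 =
  (mdeg m1 < mdeg m2)%N || (mdeg m1 == mdeg m2) && (m2 <= m1)%O.
Proof.
rewrite /grevlex; have [->|ne12] /= := eqVneq m1 m2.
  by rewrite eqxx lexx orbT.
congr orb; have [eq_d|//] /= := eqVneq (mdeg m1) (mdeg m2).
rewrite le_eqVlt eq_sym (negPf ne12) /=.
apply/existsP/(ltmcP (esym eq_d)) => [[i /andP[lt_i /forallP eq_i]]|].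
  by exists i => // j /(implyP (eq_i j))/eqP.
by case=> i eq_i lt_i; exists i; rewrite lt_i; apply/forallP=> j;
   apply/implyP=> /eq_i->.
Qed.

Lemma grevlex_refl n : reflexive (@grevlex n).
Proof. by move=> m; rewrite /grevlex eqxx. Qed.

Lemma grevlex_total n : total (@grevlex n).
Proof.
by move=> m1 m2; rewrite !grevlexE; case: ltngtP => //= _; apply: le_total.
Qed.

Lemma grevlex_anti n : antisymmetric (@grevlex n).
Proof.
move=> m1 m2; rewrite !grevlexE; case: ltngtP => //= _ le12.
by apply/le_anti; rewrite andbC.
Qed.

Lemma grevlex_trans n : transitive (@grevlex n).
Proof.
move=> m2 m1 m3; rewrite !grevlexE.
case: (ltngtP (mdeg m1) (mdeg m2)) => //= [lt12|->] => [_|le21].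
  by case/orP=> [/(ltn_trans lt12)->//|/andP[/eqP<- _]]; rewrite lt12.
case: (ltngtP (mdeg m2) (mdeg m3)) => //= _ le32.
exact: le_trans le32 le21.
Qed.

Lemma grevlex0m n (m : 'X_{1..n}) : grevlex 0%MM m.
Proof.
rewrite grevlexE; have [->|nz_m] := eqVneq m 0%MM; first by rewrite lexx eqxx orbT.
by rewrite mdeg0 lt0n mdeg_eq0 nz_m.
Qed.

Section LeadTerm.
Context {n : nat} {R : nzRingType}.
Implicit Types f : {mpoly R[n]}.

Definition grevlex_max (m1 m2 : 'X_{1..n}) : 'X_{1..n} :=
  if grevlex m1 m2 then m2 else m1.

(* [lead_mon 0] is the dummy value 0%MM. *)
Definition lead_mon f : 'X_{1..n} := \big[grevlex_max/0%MM]_(m <- msupp f) m.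

Definition lead_term f : {mpoly R[n]} := f@_(lead_mon f) *: 'X_[lead_mon f].

Lemma lead_mon_max f m : m \in msupp f -> grevlex m (lead_mon f).
Proof.
rewrite /lead_mon; elim: (msupp f) => // m' s IHs.
rewrite inE big_cons {1}/grevlex_max => /predU1P[->|/IHs le_m].
  by case: ifP => // _; apply: grevlex_refl.
case: ifPn => // nle; apply: grevlex_trans le_m _.
by have /orP[le|//] := grevlex_total m' (\big[grevlex_max/0%MM]_(j <- s) j);
   rewrite le in nle.
Qed.

Lemma lead_mon_supp f : f != 0 -> lead_mon f \in msupp f.
Proof.
rewrite -msupp_eq0 /lead_mon; elim: (msupp f) => // m s IHs _.
rewrite big_cons {1}/grevlex_max; case: ifPn => [le|_]; last exact: mem_head.
case: s IHs le => [_|m' s IHs _]; last by rewrite inE IHs ?orbT.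
rewrite big_nil => le; rewrite inE.
by rewrite (@grevlex_anti _ m 0%MM) ?eqxx // le grevlex0m.
Qed.

End LeadTerm.

Section Sagbi.
Context {K : fieldType} {n m : nat}.
Implicit Types (A : {mpoly K[n]} -> Prop) (B : m.-tuple {mpoly K[n]}).
Implicit Types (h : {mpoly K[n]}) (P Q : {mpoly K[m]}).

Definition alg_gen B h : Prop := exists P, h = P \mPo B.

(* The span of the lead monomials of the nonzero elements of A. *)
Definition lead_term_alg A h : Prop :=
  exists2 s : seq (K * {mpoly K[n]}),
    forall cf, cf \in s -> A cf.2 /\ cf.2 != 0
    & h = \sum_(cf <- s) cf.1 *: 'X_[lead_mon cf.2].

Definition sagbi_basis B A : Prop :=
  (forall b, b \in B -> A b) /\
  (forall h, alg_gen [tuple 'X_[lead_mon (tnth B i)] | i < m] h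
             <-> lead_term_alg A h).

(* A polynomial over the generators B is represented by P, standing for
   P \mPo B; subduction is recorded on the representing polynomials, so that
   c *: 'X_[I] stands for the scalar multiple c b^I of a product of generators.
   [subducts B P Q] : Q is obtained from P by finitely many steps. *)
Inductive subducts B : {mpoly K[m]} -> {mpoly K[m]} -> Prop :=
| subducts_refl P : subducts B P P
| subducts_step P Q (c : K) (I : 'X_{1..m}) :
    P \mPo B != 0 ->
    lead_term ((c *: 'X_[I]) \mPo B) = lead_term (P \mPo B) ->
    subducts B (P - c *: 'X_[I]) Q ->
    subducts B P Q.

(* Q = P - \sum_I c_I b^I is a relation constructed by subducting P to 0. *)
Definition subduction_relation B P Q : Prop :=
  subducts B P Q /\ Q \mPo B = 0.

Definition relations_generated_by B (Q1 Q2 : {mpoly K[m]}) : Prop :=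
  forall P, P \mPo B = 0 <-> exists C1 C2, P = C1 * Q1 + C2 * Q2.

End Sagbi.

(* The quotient of F by 'X_i ^+ d, when 'X_i ^+ d divides F. *)
Definition divX {n} {R : nzRingType} (i : 'I_n) (d : nat) (F : {mpoly R[n]}) :
    {mpoly R[n]} :=
  \sum_(m <- msupp F) F@_m *: 'X_[m - U_(i) *+ d].

Lemma divXK n (R : nzRingType) (i : 'I_n) (d : nat) (Q : {mpoly R[n]}) :
  divX i d (Q * 'X_i ^+ d) = Q.
Proof.
rewrite mpolyXn /divX (perm_big _ (msuppMX _ _)) big_map.
rewrite [RHS]mpolyE; apply: eq_bigr => m _.
by rewrite mcoeffMX addmC addmK.
Qed.

Lemma comp_mpolyA (R : comNzRingType) n k l (f : {mpoly R[n]})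
    (t : n.-tuple {mpoly R[k]}) (u : k.-tuple {mpoly R[l]}) :
  (f \mPo t) \mPo u = f \mPo map_tuple (comp_mpoly u) t.
Proof.
rewrite [f \mPo t]comp_mpolyEX [RHS]comp_mpolyEX raddf_sum.
apply: eq_bigr => m _ /=; rewrite comp_mpolyZ !comp_mpolyX rmorph_prod /=.
by congr (_ *: _); apply: eq_bigr => i _; rewrite rmorphXn tnth_map.
Qed.

Section Shear.
Context {K : comNzRingType}.
Implicit Types (a b : K) (f : {mpoly K[3]}).

(* The substitution x -> x, y -> y + a x, z -> z + 2 a y + (a^2 + b) x. *)
Definition shear a b f : {mpoly K[3]} :=
  f \mPo [tuple 'X_0; 'X_1 + a *: 'X_0;
                'X_2%:R + (2%:R * a) *: 'X_1 + (a ^+ 2 + b) *: 'X_0].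

Lemma shear0 f : shear 0 0 f = f.
Proof.
rewrite /shear mulr0 expr0n !addr0 !scale0r !addr0 -[RHS]comp_mpoly_id.
congr (_ \mPo _); apply: eq_from_tnth => i; rewrite tnth_mktuple.
by case: i => [[|[|[|//]]] lti]; rewrite (tnth_nth 0) /=;
   congr 'X_[U_(_)]; apply: val_inj.
Qed.

Lemma shearD a b c d f : shear c d (shear a b f) = shear (a + c) (b + d) f.
Proof.
rewrite /shear comp_mpolyA; congr (_ \mPo _); apply: eq_from_tnth => i.
rewrite tnth_map.
case: i => [[|[|[|//]]] lti]; rewrite !(tnth_nth 0) /=;
  rewrite ?(comp_mpolyD, comp_mpolyZ) !comp_mpolyXU //= -!mul_mpolyC;
  rewrite ?(expr2, mpolyCD, mpolyCM, mulr2n, mpolyC1); ring.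
Qed.

Lemma iter_shear a b n f : iter n (shear a b) f = shear (a *+ n) (b *+ n) f.
Proof.
elim: n => [|n IHn] /=; first by rewrite !mulr0n shear0.
by rewrite IHn shearD !mulrSr.
Qed.
End Shear.

(* Everything below is set up for an arbitrary field K and an arbitrary matrix
   X in place of the matrix (x_rc) of indeterminates; X is [genX p] for the
   generic representation.  Rows and columns of X are counted from 0. *)
Section Representation.
Context {K : fieldType} (p : nat) (X : 'M[K]_(2, 3)).

Local Notation S := {mpoly K[3]}.
Local Notation x := ('X_0 : S).
Local Notation y := ('X_1 : S).
Local Notation z := ('X_2%:R : S).

(* The map f |-> f . e_i. *)
Definition rep_gen (i : 'I_3) (f : S) : S := shear (X 0 i) (X 1 i) f.

(* (Z/p)^3 is 'rV['F_p]_3, written additively, and e_i is [delta_mx 0 i]; the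
   entries of g are coerced to nat. *)
Definition rep_act (g : 'rV['F_p]_3) (f : S) : S :=
  iter (g 0 2%:R) (rep_gen 2%:R) (iter (g 0 1) (rep_gen 1)
    (iter (g 0 0) (rep_gen 0) f)).

Lemma rep_act_delta (i : 'I_3) (f : S) :
  rep_act (delta_mx 0 i : 'rV['F_p]_3) f = rep_gen i f.
Proof.
by rewrite /rep_act !mxE !eqxx /=; case: i => [[|[|[|//]]] lti] /=;
   congr (rep_gen _ f); apply: val_inj.
Qed.

Lemma rep_actE (g : 'rV['F_p]_3) (f : S) :
  rep_act g f = shear (\sum_i X 0 i *+ g 0 i) (\sum_i X 1 i *+ g 0 i) f.
Proof.
rewrite /rep_act /rep_gen !iter_shear !shearD.
have e1 : lift ord0 ord0 = 1 :> 'I_3 by apply: val_inj.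
have e2 : lift ord0 (lift ord0 ord0) = 2%:R :> 'I_3 by apply: val_inj.
by rewrite !big_ord_recl !big_ord0 e2 e1 !addr0 !addrA.
Qed.

Lemma rep_act0 (f : S) : rep_act 0 f = f.
Proof. by rewrite /rep_act !mxE. Qed.

Lemma rep_actD (g h : 'rV['F_p]_3) (f : S) :
  p \in [pchar K] -> rep_act (g + h) f = rep_act h (rep_act g f).
Proof.
move=> pcharK; have p_pr := pcharf_prime pcharK.
have FpD (u : K) (a b : 'F_p) : u *+ (a + b)%R = u *+ a + u *+ b.
  have modE m : (m %% (Zp_trunc (pdiv p)).+2 = m %% p)%N by rewrite Fp_cast.
  rewrite -mulrnDr /= modE [in RHS](divn_eq (a + b) p) mulrnDr mulnC mulrnA.
  by rewrite -[u *+ p]mulr_natr (pcharf0 pcharK) mulr0 mul0rn add0r.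
have sumD r : \sum_i X r i *+ (g + h)%R 0 i
    = \sum_i X r i *+ g 0 i + \sum_i X r i *+ h 0 i.
  by rewrite -big_split; apply: eq_bigr => i _; rewrite mxE FpD.
by rewrite !rep_actE shearD !sumD.
Qed.

Definition in_invariant_ring (f : S) : Prop :=
  forall g : 'rV['F_p]_3, rep_act g f = f.

(* The product over the orbit, not over the group. *)
Definition normz : S :=
  \prod_(h <- undup [seq rep_act g z | g : 'rV['F_p]_3]) h.

(* Rows are counted from 0 here: rows 0, 2, 4 are the p^0, p^1, p^2-th powers
   of (x_11, x_12, x_13), rows 1, 3 those of (x_21, x_22, x_23). *)
Definition Gamma : 'M[K]_(5, 3) :=
  \matrix_(r, c) X (inord (r %% 2)) c ^+ (p ^ (r %/ 2)).

(* gamma i j k is the minor on rows i, j, k, counted from 1. *)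
Definition gamma (i j k : nat) : K :=
  \det (\matrix_(r < 3) row (inord (nth 0 [:: i; j; k] r).-1) Gamma).

Definition delta : S := y ^+ 2 - x * z.

Definition f1 : S :=
  - (gamma 1 2 3 *: delta ^+ p)
  - gamma 1 2 4 *: (x ^+ p * y ^+ p)
  - gamma 1 3 4 *: (delta * x ^+ (2 * p - 2))
  - gamma 2 3 4 *: (y * x ^+ (2 * p - 1)).

Definition f2 : S :=
  gamma 1 2 3 *: y ^+ (p ^ 2)
  - gamma 1 2 5 *: (y ^+ p * x ^+ (p ^ 2 - p))
  - gamma 1 3 5 *: (delta * x ^+ (p ^ 2 - 2))
  - gamma 2 3 5 *: (y * x ^+ (p ^ 2 - 1)).

Definition f3_num : S :=
  f1 ^+ p + gamma 1 2 3 ^+ (p - 2) *: f2 ^+ 2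
  + (2%:R * (- gamma 1 2 3) ^+ (p - 3)./2 * gamma 1 2 5)
      *: (x ^+ (p ^ 2 - p) * f1 ^+ (p + 1)./2).

(* f3_num / (- 2 x ^ (p^2 - 2)); that the division is exact amounts to
   f3_num + 2 x ^ (p^2 - 2) f3 = 0. *)
Definition f3 : S := (- 2%:R)^-1 *: divX 0 (p ^ 2 - 2) f3_num.

Definition gens : 5.-tuple S := [tuple x; f1; f2; f3; normz].

(* The generators x, f1, f2, f3, N(z) are represented by the variables
   'X_0, ..., 'X_4 of the following two polynomials. *)
Definition subduct_input : {mpoly K[5]} :=
  'X_3%:R ^+ p
  + (gamma 1 3 5 ^+ p * gamma 1 2 3 ^+ (p ^ 2 - 2 * p - 1))
      *: ('X_1 * 'X_2%:R ^+ p).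

Definition rel2 : {mpoly K[5]} :=
  'X_1 ^+ p + gamma 1 2 3 ^+ (p - 2) *: 'X_2%:R ^+ 2
  + (2%:R * (- gamma 1 2 3) ^+ (p - 3)./2 * gamma 1 2 5)
      *: ('X_0 ^+ (p ^ 2 - p) * 'X_1 ^+ (p + 1)./2)
  + 2%:R *: ('X_0 ^+ (p ^ 2 - 2) * 'X_3%:R).

End Representation.

Notation genK p := {fraction {mpoly 'F_p[2 * 3]}}.

Definition genX p : 'M[genK p]_(2, 3) :=
  \matrix_(r, c) tofrac ('X_(mxvec_index r c) : {mpoly 'F_p[2 * 3]}).

Lemma pchar_genK p : prime p -> p \in [pchar (genK p)].
Proof.
move=> p_pr; apply: (rmorph_pchar (@tofrac {mpoly 'F_p[2 * 3]})).
by apply: (rmorph_pchar (@mpolyC (2 * 3) 'F_p)); apply: pchar_Fp.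
Qed.

(* Main.v *)
(* An invariant h with leading monomial divisible by x is x times an invariant,
   so one may assume h homogeneous and not divisible by x.  Dividing by N_G(z),
   which is monic in z of degree p^3, and using that a polynomial of z-degree
   < p^3 restricts on x = 0 to a constant in z if it is invariant, one is reduced
   to leading monomials y^d.  The exponents 2p, p^2, p^2 + 2 of f1, f2, f3
   generate a symmetric semigroup with largest gap p^3 - 2: if d is a gap, then
   p^3 - 2 - d is not, and multiplying h by a monomial in f1, f2, f3 produces an
   invariant with leading monomial y^(p^3 - 2).  This is impossible: on z = 0,
   x = 1 that coefficient is, by Lagrange interpolation at the points t_g where
   g.z vanishes (g <> 0), a sum of terms indexed by g, and the terms of g and -g
   cancel, because t_g and t_(-g) are in the same orbit.
   Hence the leading monomials of the generators generate the lead term algebra.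
   The two relations rewrite X_3^p and X_2^2 into lower terms, and the monomials
   divisible by neither have pairwise distinct leading monomials. *)
Require Import Defs.
From mathcomp Require Import all_boot all_order all_algebra.
From mathcomp Require Import mpoly ring zify.

Set Implicit Arguments.
Unset Strict Implicit.
Unset Printing Implicit Defensive.

Import Order.TTheory GRing.Theory.
Local Open Scope ring_scope.

(** * Graded reverse lexicographic leading monomials and subduction *)

Section Grevlex.
Context {n : nat}.
Implicit Types (m : 'X_{1..n}).

Lemma grevlex_add2r m m1 m2 : grevlex (m1 + m) (m2 + m) = grevlex m1 m2.
Proof. by rewrite !grevlexE !mdegD ltn_add2r eqn_add2r lemc_add2l. Qed.

Lemma grevlex_add m1 m2 m3 m4 :
  grevlex m1 m2 -> grevlex m3 m4 -> grevlex (m1 + m3) (m2 + m4).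
Proof.
move=> le12 le34; apply: (@grevlex_trans _ (m2 + m3)%MM).
  by rewrite grevlex_add2r.
by rewrite ![(m2 + _)%MM]addmC grevlex_add2r.
Qed.

Lemma grevlex_add_eq m1 m2 m3 m4 : grevlex m1 m2 -> grevlex m3 m4 ->
  (m1 + m3)%MM = (m2 + m4)%MM -> m1 = m2 /\ m3 = m4.
Proof.
move=> le12 le34 eqm; have eq12 : m1 = m2.
  apply: grevlex_anti; rewrite le12 -(grevlex_add2r m3) eqm.
  by rewrite ![(m2 + _)%MM]addmC grevlex_add2r.
by split=> //; move: eqm; rewrite eq12 => /addmI.
Qed.

Lemma grevlex_mdeg m1 m2 : grevlex m1 m2 -> (mdeg m1 <= mdeg m2)%N.
Proof. by rewrite grevlexE => /orP[/ltnW|/andP[/eqP->]]. Qed.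

(** Monomials below [m] have degree at most [mdeg m], so there are finitely many of them; the
    induction runs on their number [mu]. *)
Lemma grevlex_ind (P : 'X_{1..n} -> Prop) :
  (forall m, (forall m', grevlex m' m -> m' != m -> P m') -> P m) -> forall m, P m.
Proof.
move=> IH m; pose mu D m := #|[pred k : 'X_{1..n < D} | grevlex k m]|.
suff main D k (m' : 'X_{1..n < D}) : (mu D m' < k)%N -> P m'.
  exact: (main _ _ (BMultinom (ltnSn (mdeg m))) (ltnSn _)).
elim: k m' => // k IHk m1 lt_k; apply: IH => m2 le_m ne_m.
have lt_D := leq_ltn_trans (grevlex_mdeg le_m) (bmdeg m1).
apply: (IHk (BMultinom lt_D)); rewrite -ltnS; apply: leq_trans lt_k; rewrite ltnS.
apply: proper_card; apply/properP; split.
  by apply/subsetP => k'; rewrite 2!unfold_in => le1; apply: grevlex_trans le1 le_m.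
exists m1; rewrite unfold_in ?grevlex_refl //.
by apply: contra ne_m => ge_m; apply/eqP/grevlex_anti; rewrite le_m.
Qed.

End Grevlex.

(** * Leading monomials and coefficients under ring operations *)

Section Lead.
Context {n : nat} {R : idomainType}.
Implicit Types (f g : {mpoly R[n]}) (m : 'X_{1..n}).

Definition lead_le f m := forall m', m' \in msupp f -> grevlex m' m.

(* The coefficient c may be 0, in which case m is only an upper bound. *)
Definition has_lead f m (c : R) := lead_le f m /\ f@_m = c.

Lemma lead_mon_has_lead f m c : c != 0 -> has_lead f m c -> lead_mon f = m.
Proof.
move=> nz_c [le_m f_m]; have supp_m : m \in msupp f by rewrite mcoeff_msupp f_m.
apply: grevlex_anti; rewrite lead_mon_max // andbT; apply: le_m.
by apply: lead_mon_supp; apply: contraTneq supp_m => ->; rewrite msupp0.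
Qed.

Lemma has_lead_lead_mon f : has_lead f (lead_mon f) f@_(lead_mon f).
Proof. by split=> // m'; apply: lead_mon_max. Qed.

Lemma mcoeff_lead_eq0 f : (f@_(lead_mon f) == 0) = (f == 0).
Proof.
have [->|nz_f] := eqVneq f 0; first by rewrite mcoeff0 eqxx.
by rewrite mcoeff_eq0 lead_mon_supp.
Qed.

Lemma has_leadD f g m c d :
  has_lead f m c -> has_lead g m d -> has_lead (f + g) m (c + d).
Proof.
move=> [le_f f_m] [le_g g_m]; split; last by rewrite mcoeffD f_m g_m.
by move=> m' /msuppD_le; rewrite mem_cat => /orP[/le_f|/le_g].
Qed.

Lemma has_leadZ f m c a : has_lead f m c -> has_lead (a *: f) m (a * c).
Proof.
move=> [le_f f_m]; split; last by rewrite mcoeffZ f_m.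
by move=> m' /msuppZ_le /le_f.
Qed.

Lemma has_leadN f m c : has_lead f m c -> has_lead (- f) m (- c).
Proof. by rewrite -scaleN1r -[- c]mulN1r; apply: has_leadZ. Qed.

Lemma has_leadM f g m1 m2 c d :
  has_lead f m1 c -> has_lead g m2 d -> has_lead (f * g) (m1 + m2) (c * d).
Proof.
move=> [le_f f_m] [le_g g_m]; split.
  move=> m /msuppM_le /allpairsP[[a b] /= [/le_f le_a /le_g le_b ->]].
  exact: grevlex_add.
rewrite mcoeffM -f_m -g_m.
have [lt1 lt2] : (mdeg m1 < (mdeg (m1 + m2)).+1)%N /\
   (mdeg m2 < (mdeg (m1 + m2)).+1)%N by rewrite mdegD !ltnS leq_addr leq_addl.
(* By [grevlex_add_eq], (m1, m2) is the only pair of exponents that can contribute to the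
   coefficient of m1 + m2. *)
rewrite (bigD1 (BMultinom lt1, BMultinom lt2)) //= big1 ?addr0 //.
move=> [a b] /= /andP[/eqP eq_m ne_ab]; have [->|] := eqVneq f@_a 0.
  by rewrite mul0r.
have [->|] := eqVneq g@_b 0; first by rewrite mulr0.
rewrite -!mcoeff_msupp => /le_g le_b /le_f le_a.
have [eq1 eq2] := grevlex_add_eq le_a le_b (esym eq_m).
by case/eqP: ne_ab; congr (_, _); apply: val_inj.
Qed.

Lemma has_lead1 : has_lead (1 : {mpoly R[n]}) 0%MM 1.
Proof.
by split=> [m|]; rewrite ?msupp1 ?inE ?mcoeff1 ?eqxx // => /eqP->;
  apply: grevlex_refl.
Qed.

Lemma has_leadX f m c k : has_lead f m c -> has_lead (f ^+ k) (m *+ k) (c ^+ k).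
Proof.
move=> f_m; elim: k => [|k IHk]; first by rewrite mulm0n !expr0; apply: has_lead1.
by rewrite !exprS mulmS; apply: has_leadM.
Qed.

Lemma has_lead_prod (I : Type) (r : seq I) (F : I -> {mpoly R[n]})
    (m : I -> 'X_{1..n}) (c : I -> R) :
  (forall i, has_lead (F i) (m i) (c i)) ->
  has_lead (\prod_(i <- r) F i) (\sum_(i <- r) m i)%MM (\prod_(i <- r) c i).
Proof.
move=> F_m; elim: r => [|i r IHr]; first by rewrite !big_nil; apply: has_lead1.
by rewrite !big_cons; apply: has_leadM.
Qed.

Lemma has_leadXm m : has_lead ('X_[m] : {mpoly R[n]}) m 1.
Proof.
by split=> [m'|]; rewrite ?msuppX ?inE ?mcoeffX ?eqxx // => /eqP->;
  apply: grevlex_refl.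
Qed.

Lemma has_lead_neq0 f m c : c != 0 -> has_lead f m c -> f != 0.
Proof. by move=> nz_c [_ f_m]; apply: contraNneq nz_c => f0; rewrite -f_m f0 mcoeff0. Qed.

Lemma lead_mon_lt f m : has_lead f m 0 -> f != 0 ->
  grevlex (lead_mon f) m /\ lead_mon f != m.
Proof.
move=> [le_m f_m] nz_f; split; first exact/le_m/lead_mon_supp.
by apply: contraNneq nz_f => eq_m; rewrite -mcoeff_lead_eq0 eq_m f_m.
Qed.

End Lead.

(** * Subduction and the SAGBI criterion *)

Section SagbiCriterion.
Context {K : fieldType} {n l : nat} (B : l.-tuple {mpoly K[n]}).
Hypothesis B_neq0 : forall i, tnth B i != 0.
Implicit Types (P Q : {mpoly K[l]}) (I J : 'X_{1..l}).

(** The exponent of the lead monomial of the product [b^I], obtained without expanding that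
    product. *)
Definition lead_exp I : 'X_{1..n} := (\sum_i lead_mon (tnth B i) *+ I i)%MM.

Lemma lead_expD I J : lead_exp (I + J) = (lead_exp I + lead_exp J)%MM.
Proof.
rewrite /lead_exp -big_split; apply: eq_bigr => i _ /=.
by apply/mnmP=> j; rewrite !(mulmnE, mnmDE) mulnDr.
Qed.

Definition lead_coeff_exp I : K :=
  \prod_i (tnth B i)@_(lead_mon (tnth B i)) ^+ I i.

Lemma lead_coeff_exp_neq0 I : lead_coeff_exp I != 0.
Proof. by apply/prodf_neq0 => i _; apply: expf_neq0; rewrite mcoeff_lead_eq0. Qed.

Lemma has_lead_gens I : has_lead ('X_[I] \mPo B) (lead_exp I) (lead_coeff_exp I).
Proof.
rewrite comp_mpolyX; apply: has_lead_prod => i.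
exact/has_leadX/has_lead_lead_mon.
Qed.

Lemma lead_mon_gens I : lead_mon ('X_[I] \mPo B) = lead_exp I.
Proof. exact: lead_mon_has_lead (lead_coeff_exp_neq0 I) (has_lead_gens I). Qed.

Lemma lead_exp1 i : lead_exp U_(i) = lead_mon (tnth B i).
Proof.
rewrite -lead_mon_gens comp_mpolyX (bigD1 i) //= mnm1E eqxx expr1.
by rewrite big1 ?mulr1 // => j nij; rewrite mnm1E eq_sym (negPf nij).
Qed.

Lemma lead_expMn I k : lead_exp (I *+ k) = (lead_exp I *+ k)%MM.
Proof.
elim: k => [|k IHk]; last by rewrite !mulmS lead_expD IHk.
rewrite !mulm0n /lead_exp big1 // => i _; by rewrite mnm0E mulm0n.
Qed.

(** The terms of [P \mPo B] have pairwise different lead monomials, so the largest of these, that of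
    [I0], cannot cancel. *)
Lemma comp_eq0_inj P : {in msupp P &, injective lead_exp} -> P \mPo B = 0 -> P = 0.
Proof.
move=> inj P0; apply/eqP; apply: contra_eqT P0 => nz_P.
have [I0 supp_I0 max_I0] : exists2 I0, I0 \in msupp P &
    forall I, I \in msupp P -> grevlex (lead_exp I) (lead_exp I0).
  move: nz_P; rewrite -msupp_eq0.
  elim: (msupp P) => // I [|J s] IHs _.
    by exists I; rewrite ?mem_head // => J; rewrite inE => /eqP->; apply: grevlex_refl.
  have [//|I1 I1s max1] := IHs.
  have [le|/negP le] := boolP (grevlex (lead_exp I1) (lead_exp I)).
    exists I; first exact: mem_head.
    move=> J'; rewrite inE => /predU1P[->|/max1]; first exact: grevlex_refl.
    by move/grevlex_trans; apply.
  exists I1 => [|J']; rewrite inE ?I1s ?orbT // => /predU1P[->|/max1 //].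
  by have /orP[] := grevlex_total (lead_exp I1) (lead_exp I).
apply/eqP=> /(congr1 (mcoeff (lead_exp I0))); rewrite mcoeff0 comp_mpolyEX.
rewrite raddf_sum /= (bigD1_seq I0) ?msupp_uniq //= big1_seq => [|I].
  rewrite addr0 mcoeffZ; have [_ ->] := has_lead_gens I0.
  apply/eqP; rewrite mulf_neq0 ?lead_coeff_exp_neq0 //.
  by rewrite mcoeff_eq0 supp_I0.
move=> /andP[neI supp_I]; rewrite mcoeffZ (@memN_msupp_eq0 _ _ ('X_[I] \mPo B)) ?mulr0 //.
have [le_I _] := has_lead_gens I; apply: contra neI => /le_I ge_I.
by apply/eqP; apply: inj => //; apply: grevlex_anti; rewrite ge_I max_I0.
Qed.

Variable A : {mpoly K[n]} -> Prop.
Hypothesis A_comp : forall P, A (P \mPo B).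
Hypothesis A_lead : forall h, A h -> h != 0 -> exists I, lead_mon h = lead_exp I.

(** Both algebras are spanned by monomials, so only these need comparing: products of generators lie
    in [A] by [A_comp], and [A_lead] gives the converse. *)
Lemma sagbi_basisP : sagbi_basis B A.
Proof.
split=> [b /tnthP[i ->]|h].
  by have := A_comp 'X_i; rewrite comp_mpolyXU -tnth_nth.
split=> [[P ->]|[s A_s ->]].
  exists [seq (P@_J, 'X_[J] \mPo B) | J <- msupp P].
    move=> cf /mapP[I _ ->] /=; split; first exact: A_comp.
    exact: has_lead_neq0 (lead_coeff_exp_neq0 I) (has_lead_gens I).
  rewrite big_map comp_mpolyEX; apply: eq_bigr => I _ /=; congr (_ *: _).
  rewrite lead_mon_gens comp_mpolyX -mprodXnE; apply: eq_bigr => i _.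
  by rewrite tnth_mktuple.
elim: s A_s => [_|[c f] s IHs A_s].
  by rewrite big_nil; exists 0; rewrite comp_mpoly0.
have [|P defP] := IHs; first by move=> cf s_cf; apply: A_s; rewrite inE s_cf orbT.
have [A_f nz_f] := A_s (c, f) (mem_head _ _).
have [I lead_f] := A_lead A_f nz_f.
exists (c *: 'X_[I] + P); rewrite big_cons defP comp_mpolyD comp_mpolyZ /=.
rewrite lead_f comp_mpolyX -mprodXnE; congr (_ *: _ + _).
by apply: eq_bigr => i _; rewrite tnth_mktuple.
Qed.

(** The coefficient 0 in [has_lead] records that the old lead term has cancelled: whatever remains
    leads strictly lower. *)
Lemma lead_term_subduct P c I : P \mPo B != 0 ->
    lead_term ((c *: 'X_[I]) \mPo B) = lead_term (P \mPo B) ->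
  lead_exp I = lead_mon (P \mPo B)
  /\ has_lead ((P - c *: 'X_[I]) \mPo B) (lead_exp I) 0.
Proof.
move=> nz_P eq_lt; have lead_I := has_leadZ c (has_lead_gens I).
have lead_P := has_lead_lead_mon (P \mPo B).
(* A zero scalar would make the lead term of [P \mPo B] vanish. *)
have nz_c : c != 0.
  apply: contraNneq nz_P => c0; rewrite -mcoeff_lead_eq0; move: eq_lt.
  rewrite c0 scale0r comp_mpoly0 /lead_term mcoeff0 scale0r.
  move/(congr1 (mcoeff (lead_mon (P \mPo B)))).
  by rewrite mcoeff0 mcoeffZ mcoeffX eqxx mulr1 => <-.
have nz_cI : c * lead_coeff_exp I != 0 by rewrite mulf_neq0 ?lead_coeff_exp_neq0.
move: eq_lt; rewrite /lead_term comp_mpolyZ (lead_mon_has_lead nz_cI lead_I).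
rewrite (proj2 lead_I) => eq_lt.
have eq_m : lead_exp I = lead_mon (P \mPo B).
  have : lead_exp I \in msupp ((P \mPo B)@_(lead_mon (P \mPo B)) *: 'X_[lead_mon (P \mPo B)]).
    by rewrite -eq_lt mcoeff_msupp mcoeffZ mcoeffX eqxx mulr1.
  by move/msuppZ_le; rewrite msuppX inE => /eqP.
split=> //; rewrite comp_mpolyB comp_mpolyZ.
have eq_c : (P \mPo B)@_(lead_mon (P \mPo B)) = c * lead_coeff_exp I.
  by move/(congr1 (mcoeff (lead_exp I))): eq_lt; rewrite -eq_m !mcoeffZ mcoeffX eqxx !mulr1.
rewrite eq_c in lead_P; rewrite eq_m in lead_I *.
by rewrite -(subrr (c * lead_coeff_exp I)); apply: has_leadD => //; apply: has_leadN.
Qed.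

(** Each step subtracts a product with the current lead monomial, and these decrease. This bounds
    the terms that subduction introduces without knowing the steps taken. *)
Lemma subducts_supp P Q J : subducts B P Q -> J \in msupp (P - Q) ->
  P \mPo B != 0 /\ grevlex (lead_exp J) (lead_mon (P \mPo B)).
Proof.
elim=> [P'|P' Q' c I nz_P eq_lt _ IH]; first by rewrite subrr msupp0.
have [eq_m lead_P] := lead_term_subduct nz_P eq_lt.
rewrite -[P' - Q'](subrK (c *: 'X_[I])) [P' - Q' - _]addrAC => J_in.
split=> //; have := msuppD_le J_in; rewrite mem_cat => /orP[/IH[nz le_J]|].
  have [le_P _] := lead_mon_lt lead_P nz; rewrite -eq_m.
  exact: grevlex_trans le_J le_P.
by move/msuppZ_le; rewrite msuppX inE => /eqP->; rewrite eq_m grevlex_refl.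
Qed.

(** By [A_lead] every nonzero element admits a further step, and each step lowers the lead monomial,
    so the process ends at 0. *)
Lemma subduction_exists P : exists Q, subduction_relation B P Q.
Proof.
have [m] : exists m, m = lead_mon (P \mPo B) by exists (lead_mon (P \mPo B)).
elim/(@grevlex_ind n): m P => m IHm Q def_m.
have [Q0|nz_Q] := eqVneq (Q \mPo B) 0; first by exists Q; split=> //; constructor.
have [I def_I] := A_lead (A_comp Q) nz_Q.
pose c := (Q \mPo B)@_(lead_mon (Q \mPo B)) / lead_coeff_exp I.
have def_c : c * lead_coeff_exp I = (Q \mPo B)@_(lead_mon (Q \mPo B)).
  by rewrite divfK ?lead_coeff_exp_neq0.
have eq_lt : lead_term ((c *: 'X_[I]) \mPo B) = lead_term (Q \mPo B).
  have lead_I := has_leadZ c (has_lead_gens I); rewrite def_c in lead_I.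
  rewrite /lead_term comp_mpolyZ (lead_mon_has_lead _ lead_I) ?mcoeff_lead_eq0 //.
  by rewrite (proj2 lead_I) def_I.
have [_ lead_Q'] := lead_term_subduct nz_Q eq_lt.
set Q' := Q - c *: 'X_[I] in lead_Q'.
have [Q'0|nz_Q'] := eqVneq (Q' \mPo B) 0.
  by exists Q'; split=> //; apply: subducts_step nz_Q eq_lt _; constructor.
have [le_m ne_m] := lead_mon_lt lead_Q' nz_Q'; rewrite -def_I in le_m ne_m.
rewrite -def_m in le_m ne_m.
have [Q'' [sub_Q'' Q''0]] := IHm _ le_m ne_m Q' erefl.
by exists Q''; split=> //; apply: subducts_step nz_Q eq_lt _.
Qed.

(** * Reduction of polynomials in the generators modulo two relations *)

Variable wt : 'X_{1..l} -> nat.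
Hypothesis wtD : forall I J, wt (I + J)%MM = (wt I + wt J)%N.

(** Different products of generators may share a lead monomial; the weight [wt] breaks such ties. *)
Definition lower J I := grevlex (lead_exp J) (lead_exp I)
  && ((lead_exp J != lead_exp I) || (wt J < wt I)%N).

Lemma lower_add2l I J1 J2 : lower J1 J2 -> lower (I + J1) (I + J2).
Proof.
rewrite /lower !lead_expD !wtD ltn_add2l ![(lead_exp I + _)%MM]addmC.
by rewrite grevlex_add2r eqm_add2r.
Qed.

Lemma lower_ind (T : 'X_{1..l} -> Prop) :
  (forall I, (forall J, lower J I -> T J) -> T I) -> forall I, T I.
Proof.
move=> IH I; have [m] : exists m, m = lead_exp I by exists (lead_exp I).
elim/(@grevlex_ind n): m I => m IHm I def_m; have [k] := ubnP (wt I).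
elim: k I def_m => // k IHk I def_m lt_k; apply: IH => J /andP[le_J].
have [eq_J /= lt_J|ne_J _] := eqVneq (lead_exp J) (lead_exp I).
  by apply: IHk; rewrite ?eq_J // -ltnS; apply: leq_trans lt_k.
by apply: (IHm (lead_exp J)) => //; rewrite def_m.
Qed.

(** [Q] acts as a rewriting rule: modulo [Q], the monomial [M] is a combination of monomials
    strictly below it. *)
Definition rewrites_to_lower Q M :=
  Q@_M != 0 /\ forall J, J \in msupp Q -> J != M -> lower J M.

(** Division with remainder: rewriting a monomial divisible by [M1] or [M2] produces lower ones, and
    [lower] is well founded and compatible with products. *)
Lemma normal_form_exists Q1 Q2 M1 M2 P :
    rewrites_to_lower Q1 M1 -> rewrites_to_lower Q2 M2 ->
  exists C1 C2 R, P = C1 * Q1 + C2 * Q2 + R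
    /\ forall J, J \in msupp R -> ~~ (M1 <= J)%MM && ~~ (M2 <= J)%MM.
Proof.
move=> red1 red2.
pose T P := exists C1 C2 R, P = C1 * Q1 + C2 * Q2 + R
    /\ forall J, J \in msupp R -> ~~ (M1 <= J)%MM && ~~ (M2 <= J)%MM.
have addT P1 P2 : T P1 -> T P2 -> T (P1 + P2).
  move=> [C1 [C2 [R [-> irrR]]]] [C1' [C2' [R' [-> irrR']]]].
  exists (C1 + C1'), (C2 + C2'), (R + R'); split; first by ring.
  by move=> J /msuppD_le; rewrite mem_cat => /orP[/irrR|/irrR'].
have scaleT c P1 : T P1 -> T (c *: P1).
  move=> [C1 [C2 [R [-> irrR]]]]; exists (c *: C1), (c *: C2), (c *: R).
  by split=> [|J /msuppZ_le/irrR //]; rewrite !scalerDr !scalerAl.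
have T0 : T 0 by exists 0, 0, 0; split=> [|J]; rewrite ?msupp0 // !mul0r !addr0.
have sumT (r : seq 'X_{1..l}) (c : 'X_{1..l} -> K) (F : 'X_{1..l} -> {mpoly K[l]}) :
    (forall J, J \in r -> T (F J)) -> T (\sum_(J <- r | J \in r) c J *: F J).
  by move=> TF; apply: big_ind => // J /TF TFJ; apply: scaleT.
(* Up to a scalar, ['X_[I + M]] is ['X_[I] * Q] minus ['X_[I]] times the other terms of [Q], all of
   which are lower. *)
have stepT Q M I : rewrites_to_lower Q M -> T ('X_[I] * Q) ->
    (forall J, lower J (I + M) -> T 'X_[J]) -> T 'X_[I + M].
  move=> [nz_QM lowQ] T_IQ IH.
  have -> : 'X_[I + M] = (Q@_M)^-1 *: ('X_[I] * Q
      + (- 1) *: ('X_[I] * (Q - Q@_M *: 'X_[M]))).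
    rewrite scaleN1r -mulrBr opprB addrC subrK -scalerAr scalerA mulVf // scale1r.
    by rewrite mpolyXD.
  apply/scaleT/addT => //; apply: scaleT.
  rewrite (mpolyE (Q - _)) big_seq mulr_sumr.
  under eq_bigr => J _ do rewrite -scalerAr -mpolyXD.
  apply: (sumT _ _ (fun J => 'X_[I + J])) => J supp_J; apply/IH/lower_add2l.
  have ne_J : J != M.
    apply: contraTneq supp_J => ->.
    by rewrite mcoeff_msupp mcoeffB mcoeffZ mcoeffX eqxx mulr1 subrr eqxx.
  apply: lowQ => //; move: supp_J; rewrite !mcoeff_msupp mcoeffB mcoeffZ mcoeffX.
  by rewrite [M == J]eq_sym (negPf ne_J) mulr0 subr0.
have TX I : T 'X_[I].
  elim/lower_ind: I => I IH.
  have [le1|nle1] := boolP (M1 <= I)%MM.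
    rewrite -(submK le1); apply: (stepT Q1) => // [|J]; last by rewrite submK //; apply: IH.
    by exists 'X_[I - M1], 0, 0; split=> [|J]; rewrite ?msupp0 // mul0r !addr0.
  have [le2|nle2] := boolP (M2 <= I)%MM.
    rewrite -(submK le2); apply: (stepT Q2) => // [|J]; last by rewrite submK //; apply: IH.
    by exists 0, 'X_[I - M2], 0; split=> [|J]; rewrite ?msupp0 // mul0r add0r addr0.
  exists 0, 0, 'X_[I]; split=> [|J]; first by rewrite !mul0r !add0r.
  by rewrite msuppX inE => /eqP->; rewrite nle1.
by rewrite (mpolyE P) big_seq; apply: (sumT _ _ (fun J => 'X_[J])) => J _; apply: TX.
Qed.

(** The remainder of a relation is again a relation, and its monomials have distinct lead monomials
    at the generators, so it vanishes by [comp_eq0_inj]. *)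
Lemma relations_generated_byP Q1 Q2 M1 M2 :
    rewrites_to_lower Q1 M1 -> rewrites_to_lower Q2 M2 ->
    Q1 \mPo B = 0 -> Q2 \mPo B = 0 ->
    {in [pred J | ~~ (M1 <= J)%MM && ~~ (M2 <= J)%MM] &, injective lead_exp} ->
  relations_generated_by B Q1 Q2.
Proof.
move=> red1 red2 Q1_0 Q2_0 inj P; split=> [P0|[C1 [C2 ->]]]; last first.
  by rewrite comp_mpolyD !rmorphM /= Q1_0 Q2_0 !mulr0 addr0.
have [C1 [C2 [R [defP irrR]]]] := normal_form_exists P red1 red2.
exists C1, C2; rewrite defP (_ : R = 0) ?addr0 //; apply: comp_eq0_inj.
  by move=> I J /irrR irrI /irrR irrJ; apply: inj.
by move: P0; rewrite defP !comp_mpolyD !rmorphM /= Q1_0 Q2_0 !mulr0 !add0r.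
Qed.

End SagbiCriterion.

(** * Interpolation, and the semigroup of exponents *)

Section Univariate.
Context {F : fieldType} {I : finType}.
Implicit Types (u : {poly F}).

Lemma roots_poly_eq0 (P : pred I) (t : I -> F) u :
  {in P &, injective t} -> (size u <= #|P|)%N -> (forall i, P i -> root u (t i)) ->
  u = 0.
Proof.
move=> inj_t le_u root_u; apply/eqP; apply: contraLR le_u => nz_u; rewrite -ltnNge.
have := @max_poly_roots _ u [seq t i | i <- enum P] nz_u.
rewrite size_map -cardE; apply.
  by apply/allP => x /mapP[i Pi ->]; apply: root_u; rewrite mem_enum in Pi.
by rewrite map_inj_in_uniq ?enum_uniq // => i j; rewrite !mem_enum; apply: inj_t.
Qed.

(** [u] equals its interpolant [v], and each basis polynomial [ell i] is monic of degree
    [#|P| - 1]. *)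
Lemma lagrange_lead_coef (P : pred I) (t : I -> F) u :
  {in P &, injective t} -> (0 < #|P|)%N -> (size u <= #|P|)%N ->
  u`_(#|P|).-1 = \sum_(i | P i) u.[t i] / \prod_(j | P j && (j != i)) (t i - t j).
Proof.
move=> inj_t gt0 le_u.
pose ell i := \prod_(j | P j && (j != i)) ('X - (t j)%:P).
pose w i := \prod_(j | P j && (j != i)) (t i - t j).
have ell_i i : (ell i).[t i] = w i.
  by rewrite horner_prod; apply: eq_bigr => j _; rewrite hornerXsubC.
have size_ell i : P i -> size (ell i) = #|P|.
  move=> Pi; rewrite /ell -big_filter size_prod_XsubC size_filter.
  rewrite (cardD1 i) unfold_in Pi add1n cardE /enum_mem size_filter.
  by congr _.+1; apply: eq_in_count => j _; rewrite /= !inE andbC.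
have nz_w i : P i -> w i != 0.
  move=> Pi; apply/prodf_neq0 => j /andP[Pj ne_ji]; rewrite subr_eq0.
  by apply: contraNneq ne_ji => /inj_t eq_ij; rewrite eq_ij.
pose v := \sum_(i | P i) (u.[t i] / w i) *: ell i.
have def_u : u = v.
  apply/eqP; rewrite -subr_eq0; apply/eqP; apply: (roots_poly_eq0 inj_t).
    rewrite (leq_trans (size_polyD _ _)) // geq_max le_u size_polyN.
    apply: (leq_trans (size_sum _ _ _)); apply/bigmax_leqP => i Pi.
    by rewrite (leq_trans (size_scale_leq _ _)) // size_ell.
  move=> i Pi; rewrite /root !hornerE horner_sum (bigD1 i) //= big1.
    by rewrite addr0 hornerZ ell_i divfK ?nz_w ?subrr.
  move=> j /andP[Pj ne_ji]; rewrite hornerZ horner_prod (bigD1 i) /=; last by rewrite Pi eq_sym.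
  by rewrite hornerXsubC subrr mul0r mulr0.
rewrite {1}def_u coef_sum; apply: eq_bigr => i Pi; rewrite coefZ.
have /monicP : ell i \is monic by apply: monic_prod_XsubC.
by rewrite /lead_coef size_ell // => ->; rewrite mulr1.
Qed.

(** The difference of [u] and its value at 0 has [#|I|] roots, too many for its size. *)
Lemma const_on_injective_const (a : I -> F) u : injective a ->
  (size u <= #|I|)%N -> (forall i, u.[a i] = u.[0]) -> u = (u.[0])%:P.
Proof.
move=> inj_a le_u inv_u; apply/eqP; rewrite -subr_eq0; apply/eqP.
have [I0|I_gt0] := posnP #|I|.
  by move: le_u; rewrite I0 leqn0 size_poly_eq0 => /eqP->; rewrite horner0 subr0.
apply: (@roots_poly_eq0 predT a) => [i j _ _||i _]; first exact: inj_a.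
  by rewrite (leq_trans (size_polyD _ _)) // geq_max le_u size_polyN
             (leq_trans (size_polyC_leq1 _)).
by rewrite /root !hornerE inv_u subrr.
Qed.

End Univariate.

(** Every [d] is [2p i + p^2 j + (p^2 + 2) k] with integers [j] in {0, 1}, [0 <= k < p] and [i]
    possibly negative: [2k = d] modulo [p] fixes [k], then parity fixes [j]. If [i < 0], the triple
    [-1 - i], [1 - j], [p - 1 - k] represents [p^3 - 2 - d]. *)
Lemma semigroup_symmetric (p d : nat) : odd p -> (1 < p)%N ->
  exists i j k, (2 * p * i + p ^ 2 * j + (p ^ 2 + 2) * k = d)%N
    \/ (d + (2 * p * i + p ^ 2 * j + (p ^ 2 + 2) * k) = p ^ 3 - 2)%N.
Proof.
move=> odd_p p_gt1.
(* [(p + 1)/2] is the inverse of 2 modulo [p]. *)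
pose k := ((d * (p.+1)./2) %% p)%N; pose j := (odd (d + k) : nat).
have lt_k : (k < p)%N by rewrite ltn_mod; lia.
have half_p : (p.+1)./2.*2 = p.+1 by rewrite -[RHS]odd_double_half /= odd_p.
have [c def_c] : exists c, (d * p.+1 = 2 * k + p * (2 * c))%N.
  exists (d * (p.+1)./2 %/ p)%N; have def_q := divn_eq (d * (p.+1)./2) p.
  rewrite -/k in def_q; move: def_q half_p; clear lt_k; clearbody j k; clear j.
  by move: (_ ./2) => h; move: (_ %/ p)%N => q; clear; nia.
have [e def_e] : exists e, (d + k = j + 2 * e)%N.
  by exists (d + k)./2; rewrite mul2n odd_double_half.
have le_j1 : (j <= 1)%N by rewrite /j; case: odd.
pose h := p./2; have def_p : p = (2 * h).+1.
  by rewrite -[LHS]odd_double_half odd_p -mul2n.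
clearbody h j k; clear half_p odd_p; subst p.
set p := (2 * h).+1 in def_c lt_k *; have def_p : p = (2 * h).+1 by [].
clearbody p.
(* The integer [i] is [c] minus [j + e + h (j + k)]; the two parts stay on opposite sides because
   the difference may be negative. *)
have def_d : (d + 2 * p * (j + e + h * (j + k))
              = p ^ 2 * j + (p ^ 2 + 2) * k + 2 * p * c)%N.
  by rewrite def_p; nia.
have [le_c|lt_c] := leqP (j + e + h * (j + k)) c.
  exists (c - (j + e + h * (j + k)))%N, j, k; left.
  rewrite mulnBr; have := leq_mul (leqnn (2 * p)) le_c; lia.
have [i def_t] : exists i, (j + e + h * (j + k) = c + i.+1)%N.
  by exists (j + e + h * (j + k) - c).-1; lia.
have [j' def_j] : exists j', (j + j' = 1)%N by exists (1 - j)%N; lia.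
have [k' def_k] : exists k', (k + k' = 2 * h)%N by exists (2 * h - k)%N; lia.
exists i, j', k'; right; rewrite def_t {def_t def_c def_e} in def_d.
suff : (d + (2 * p * i + p ^ 2 * j' + (p ^ 2 + 2) * k') + 2 = p ^ 3)%N by lia.
have e1 : (p ^ 2 * j + p ^ 2 * j' = p ^ 2)%N by rewrite -mulnDr def_j muln1.
have e2 : ((p ^ 2 + 2) * k + (p ^ 2 + 2) * k' = (p ^ 2 + 2) * (2 * h))%N.
  by rewrite -mulnDr def_k.
have e3 : ((p ^ 2 + 2) * (2 * h) + (p ^ 2 + 2) = p ^ 3 + 2 * p)%N.
  by rewrite -mulnSr -def_p mulnDl -expnSr.
have e4 : (2 * p * (c + i.+1) = 2 * p * c + 2 * p * i + 2 * p)%N by lia.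
lia.
Qed.

(** Modulo [p] the sum is [2c], which determines [c < p]; parity then determines [b < 2]. *)
Lemma semigroup_normal_form_unique (p a b c a' b' c' : nat) :
    odd p -> (b < 2)%N -> (b' < 2)%N -> (c < p)%N -> (c' < p)%N ->
    (2 * p * a + p ^ 2 * b + (p ^ 2 + 2) * c
     = 2 * p * a' + p ^ 2 * b' + (p ^ 2 + 2) * c')%N ->
  [/\ a = a', b = b' & c = c'].
Proof.
move=> odd_p lt_b lt_b' lt_c lt_c' eq_n.
have p_gt0 : (0 < p)%N by apply: leq_ltn_trans lt_c.
have le_c d e d' e' u u' : (d <= d')%N -> (d' < p)%N ->
    (2 * p * u + p ^ 2 * e + (p ^ 2 + 2) * d
     = 2 * p * u' + p ^ 2 * e' + (p ^ 2 + 2) * d')%N -> d = d'.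
  move=> le_d lt_d eq_d.
  have : (2 * d' = 2 * d %[mod p])%N.
    have modE v w k : ((2 * p * v + p ^ 2 * w + (p ^ 2 + 2) * k) = 2 * k %[mod p])%N.
      have -> : (2 * p * v + p ^ 2 * w + (p ^ 2 + 2) * k
                 = (2 * v + p * w + p * k) * p + 2 * k)%N by lia.
      by rewrite modnMDl.
    by rewrite -(modE u' e') -eq_d modE.
  move/eqP; rewrite eqn_mod_dvd ?leq_mul2l ?le_d // -mulnBr Gauss_dvdr ?coprimen2 //.
  case: (posnP (d' - d)) => [|d_gt0 /(dvdn_leq d_gt0)]; lia.
have eq_c : c = c'.
  have [le|/ltnW le] := leqP c c'; first exact: le_c eq_n.
  by apply/esym; apply: le_c (esym eq_n).
rewrite {}eq_c in eq_n *; move/addIn: eq_n => eq_n.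
have eq_b : b = b'.
  have := congr1 odd eq_n; rewrite !oddD !oddM ?oddX odd_p /= => eq_odd.
  by clear eq_n; move: lt_b lt_b' eq_odd; case: b => [|[|]] //; case: b' => [|[|]].
rewrite {}eq_b in eq_n *; move/addIn/eqP: eq_n; rewrite eqn_pmul2l ?muln_gt0 //.
by move=> /eqP.
Qed.

(** * The obstruction in degree p^3 - 2 *)

Lemma big_I3 (R : Type) (idx : R) (op : Monoid.law idx) (F : 'I_3 -> R) :
  \big[op/idx]_(i < 3) F i = op (F 0) (op (F 1) (F 2%:R)).
Proof.
rewrite !big_ord_recl big_ord0 Monoid.mulm1.
by congr (op _ (op (F _) (F _))); apply: val_inj.
Qed.

Lemma forall_I3 (P : 'I_3 -> Prop) : P 0 -> P 1 -> P 2%:R -> forall i, P i.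
Proof.
move=> P0 P1 P2 [[|[|[|//]]] lti]; [move: P0|move: P1|move: P2];
by congr P; apply: val_inj.
Qed.

Lemma mdeg3 (m : 'X_{1..3}) : mdeg m = (m 0%R + (m 1%R + m 2%:R%R))%N.
Proof. by rewrite mdegE big_I3. Qed.

Lemma mnm3P (m1 m2 : 'X_{1..3}) :
  m1 0 = m2 0 -> m1 1 = m2 1 -> m1 2%:R = m2 2%:R -> m1 = m2.
Proof. by move=> e0 e1 e2; apply/mnmP; apply: forall_I3. Qed.

Section Shear.
Context {K : fieldType}.
Implicit Types (a b : K) (f : {mpoly K[3]}).

Lemma shearX0 a b : shear a b 'X_0 = 'X_0.
Proof. by rewrite /shear comp_mpolyXU. Qed.

Lemma shearX1 a b : shear a b 'X_1 = 'X_1 + a *: 'X_0.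
Proof. by rewrite /shear comp_mpolyXU. Qed.

Lemma shearX2 a b :
  shear a b 'X_2%:R = 'X_2%:R + (2%:R * a) *: 'X_1 + (a ^+ 2 + b) *: 'X_0.
Proof. by rewrite /shear comp_mpolyXU. Qed.

Lemma shear_meval a b f (v : 'I_3 -> K) :
  (shear a b f).@[v] = f.@[tnth [tuple v 0; v 1 + a * v 0;
                              v 2%:R + 2%:R * a * v 1 + (a ^+ 2 + b) * v 0]].
Proof.
rewrite /shear comp_mpoly_meval; apply: meval_eq.
by apply: forall_I3; rewrite !(tnth_nth 0) /= ?(mevalD, mevalZ, mevalXU).
Qed.

Definition line_poly (c : 'I_3 -> {poly K}) f : {poly K} := mmap polyC c f.

Lemma horner_line_poly c f s : (line_poly c f).[s] = f.@[fun i => (c i).[s]].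
Proof.
rewrite mevalE /line_poly /mmap horner_sum; apply: eq_bigr => m _.
rewrite hornerCM horner_prod; congr (_ * _).
by apply: eq_bigr => i _; rewrite horner_exp.
Qed.

End Shear.

(** * Interpolation at the zeros of the linear forms in the orbit of z *)

Section Residue.
Context {K : fieldType} (p : nat) (X : 'M[K]_(2, 3)).
Hypothesis pcharK : p \in [pchar K].
Hypothesis p_gt2 : (2 < p)%N.
Local Notation V := 'rV['F_p]_3.

(** The parameters of [g] as a shear: [g] acts as [shear (lin 0 g) (lin 1 g)]. *)
Definition lin (r : 'I_2) (g : V) : K := \sum_i X r i *+ g 0 i.
Local Notation al := (lin 0).
Local Notation be := (lin 1).

Lemma p_prime : prime p. Proof. exact: pcharf_prime pcharK. Qed.

Lemma card_V : #|{: V}| = (p ^ 3)%N.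
Proof. by rewrite card_mx card_Fp ?p_prime // mul1n. Qed.

Lemma two_neq0 : 2%:R != 0 :> K.
Proof. by rewrite -(dvdn_pcharf pcharK) gtnNdvd. Qed.

Lemma linD r g h : lin r (g + h) = lin r g + lin r h.
Proof.
rewrite /lin -big_split; apply: eq_bigr => i _; rewrite mxE /=.
rewrite -mulrnDr -[LHS]mulr_natr -[RHS]mulr_natr; congr (_ * _).
have modE n : (n %% (Zp_trunc (pdiv p)).+2 = n %% p)%N by rewrite (Fp_cast p_prime).
by rewrite -[RHS](GRing.natr_mod_pchar pcharK) /= modE.
Qed.

Lemma lin0 r : lin r 0 = 0.
Proof. by rewrite /lin big1 // => i _; rewrite mxE. Qed.

Lemma linN r g : lin r (- g) = - lin r g.
Proof. by apply/eqP; rewrite -addr_eq0 -linD addNr lin0. Qed.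

Lemma rep_act_shear g f : rep_act X g f = shear (al g) (be g) f.
Proof. exact: rep_actE. Qed.

(** Amounts to linear independence of the first row of [X] over the prime field. *)
Hypothesis lin0_inj : injective al.
(* The zero s of g.z at the points (1, s, 0); meaningless (0) for g = 0. *)
Definition node (g : V) : K := - (al g ^+ 2 + be g) / (2%:R * al g).
Hypothesis node_inj : {in [pred g | g != 0] &, injective node}.

Lemma lin0_neq0 g : g != 0 -> al g != 0.
Proof. by apply: contraNneq => al0; apply/eqP/lin0_inj; rewrite lin0. Qed.

(** Since g.z vanishes at (1, node g, 0), the shear by [g] moves this point to (1, node g + al g,
    0), where (-g).z vanishes. *)
Lemma nodeN g : g != 0 -> node (- g) = node g + al g.
Proof.
move=> /lin0_neq0 nz_a; rewrite /node !linN; field.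
by rewrite oppr_eq0 nz_a two_neq0.
Qed.

(* The value of g.z at the point (1, s, 0). *)
Definition orbit_line (g : V) (s : K) : K :=
  2%:R * al g * s + (al g ^+ 2 + be g).

Lemma orbit_lineE g s : g != 0 -> orbit_line g s = 2%:R * al g * (s - node g).
Proof.
by move=> /lin0_neq0 nz_a; rewrite /orbit_line /node; field; rewrite nz_a two_neq0.
Qed.

(** (g' + g).z is [g] applied to g'.z, and [g] moves the point of [node g] to that of
    [node (- g)]. *)
Lemma orbit_line_node g g' : g != 0 ->
  orbit_line (g' + g) (node g) = orbit_line g' (node (- g)).
Proof.
move=> nz_g; rewrite nodeN // /orbit_line !linD /node.
by have nz_a := lin0_neq0 nz_g; field; rewrite nz_a two_neq0.
Qed.

(** The denominator of the Lagrange term of [g]. *)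
Definition node_weight g := \prod_(j | (j != 0) && (j != g)) (node g - node j).

(** Scaling each factor by [2 al j] turns the weight into the product of the values of j.z at (1,
    node g, 0) over [j] other than 0 and [g]. Translating [j] by [g] matches this product with the
    one for [- g], whereas the scaling factor [E] changes sign. *)
Lemma node_weightN g : g != 0 -> node_weight (- g) = - node_weight g.
Proof.
move=> nz_g.
pose E g := \prod_(j | (j != 0) && (j != g)) (2%:R * al j).
have EK g' : g' != 0 -> E g' * (2%:R * al g') = \prod_(j | j != 0) (2%:R * al j).
  by move=> nz_g'; rewrite [RHS](bigD1 g') //= mulrC.
have wE g' : node_weight g' * E g'
    = \prod_(j | (j != 0) && (j != g')) orbit_line j (node g').
  rewrite -big_split; apply: eq_bigr => j /andP[nz_j _] /=.
  by rewrite orbit_lineE // mulrC.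
have nz_a := lin0_neq0 nz_g.
have nz_Ng : - g != 0 by rewrite oppr_eq0.
have EN : E (- g) = - E g.
  have := EK _ nz_Ng; rewrite -(EK _ nz_g) linN => eqE.
  apply: (mulIf (x := 2%:R * al g)); first by rewrite mulf_neq0 // two_neq0.
  by rewrite mulNr -eqE; ring.
have nz_E : E g != 0.
  apply/prodf_neq0 => j /andP[nz_j _].
  by rewrite mulf_neq0 ?two_neq0 ?lin0_neq0.
apply: (mulIf nz_E); rewrite mulNr wE -[E g]opprK -EN mulrN wE; congr (- _).
rewrite [RHS](reindex_inj (addIr g)) /=.
apply: eq_big => [j|j _]; last by rewrite orbit_line_node.
by rewrite addr_eq0 -[j + g == g]subr_eq0 addrK andbC.
Qed.

(** Excludes [y^(p^3 - 2)] as a lead monomial: the interpolation sum equals its own negative, and 2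
    is invertible. *)
Lemma residue_coef_eq0 h : in_invariant_ring p X h ->
  (forall m, m \in msupp h -> (mdeg m <= p ^ 3 - 2)%N) ->
  h@_(U_(1) *+ (p ^ 3 - 2)) = 0.
Proof.
move=> inv_h le_h.
(* The restriction of [h] to the points (1, s, 0). *)
pose u := line_poly (tnth [tuple 1; 'X; 0]) h.
have uE : u = \sum_(m <- msupp h) (h@_m * (m 2%:R == 0)%:R) *: 'X^(m 1).
  apply: eq_bigr => m _; rewrite /mmap1 big_I3 !(tnth_nth 0) /= expr1n mul1r.
  by rewrite expr0n mul_polyC; case: (_ == 0%N); rewrite !(mulr1, mulr0, scaler0, scale0r).
have size_u : (size u <= (p ^ 3 - 2).+1)%N.
  apply/leq_sizeP => k lt_k; rewrite uE coef_sum big1_seq // => m /andP[_ /le_h].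
  rewrite mdeg3 => le_m; rewrite coefZ coefXn; have [def_k|_] := eqVneq k (m 1); last by rewrite mulr0.
  by move: lt_k le_m; rewrite def_k; lia.
have u_top : u`_(p ^ 3 - 2) = h@_(U_(1) *+ (p ^ 3 - 2)).
  rewrite uE coef_sum [in RHS](mpolyE h) raddf_sum; apply: eq_big_seq => m /le_h.
  rewrite mdeg3 => le_m; rewrite /= mcoeffZ mcoeffX coefZ coefXn -mulrA -natrM mulnb.
  congr (_ * _%:R); congr nat_of_bool; apply/andP/eqP => [[/eqP m2 /eqP m1]|->].
    by apply: mnm3P; rewrite mulmnE mnm1E ?m2 -?m1 ?mul0n ?mul1n //; lia.
  by rewrite !mulmnE !mnm1E mul0n mul1n.
(* There are [p^3 - 1] nodes for degree at most [p^3 - 2], so interpolation reads off exactly the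
   wanted coefficient. *)
have card_Q : #|[pred g : V | g != 0]| = (p ^ 3 - 2).+1.
  have gt1 : (1 < p ^ 3)%N by rewrite -(exp1n 3) ltn_exp2r // (leq_trans _ p_gt2).
  have -> : (p ^ 3 - 2).+1 = (p ^ 3).-1 by lia.
  by rewrite -card_V -(cardC1 (0 : V)); apply: eq_card.
(* The two points lie in one orbit, so the invariant [h] takes the same value at both. *)
have u_node g : g != 0 -> u.[node (- g)] = u.[node g].
  move=> nz_g; rewrite !horner_line_poly -[h in RHS](inv_h g) rep_act_shear shear_meval.
  apply: meval_eq; apply: forall_I3;
    rewrite !(tnth_nth 0) ![nth _ _ _]/= ?(hornerC, hornerX) ?mulr1 //.
    by rewrite nodeN.
  by rewrite add0r -/(orbit_line g (node g)) orbit_lineE // subrr mulr0.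
rewrite -u_top; have := @lagrange_lead_coef _ _ _ node u node_inj.
rewrite card_Q /= => -> //.
set S := \sum_(i | _) _.
have SN : S = - S.
  rewrite -sumrN {1}/S (reindex_inj oppr_inj) /=.
  apply: eq_big => [g|g]; first by rewrite oppr_eq0.
  rewrite oppr_eq0 => nz_g; rewrite u_node //.
  by rewrite -!/(node_weight _) node_weightN // invrN mulrN.
have /eqP : 2%:R * S = 0 by rewrite mulr_natl mulr2n {2}SN subrr.
by rewrite mulf_eq0 (negPf two_neq0) => /eqP.
Qed.

End Residue.

(** * Homogeneity and division by the norm of z *)

Lemma grevlex3 (m1 m2 : 'X_{1..3}) : mdeg m1 = mdeg m2 ->
  grevlex m1 m2 =
  (m2 0%R < m1 0%R)%N || (m1 0 == m2 0) && (m2 1%R <= m1 1%R)%N.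
Proof.
move=> eq_d; rewrite /grevlex eq_d eqxx ltnn /=.
apply/orP/orP => [[/eqP->|/existsP[i /andP[]]]|].
- by right; rewrite eqxx leqnn.
- elim/forall_I3: i => lt_i /forallP eq_i; first by left.
    by right; rewrite (implyP (eq_i 0)) //= ltnW.
  have := eq_i 0; have := eq_i 1; rewrite /= => /eqP e1 /eqP e0.
  by right; rewrite e0 e1 eqxx leqnn.
case=> [lt0|/andP[/eqP e0]].
  by right; apply/existsP; exists 0; rewrite lt0; apply/forallP; apply: forall_I3.
rewrite leq_eqVlt => /orP[/eqP e1|lt1].
  by left; apply/eqP/mnm3P => //; move: eq_d; rewrite !mdeg3 e0 e1; lia.
by right; apply/existsP; exists 1; rewrite lt1; apply/forallP; apply: forall_I3 => //=;
  rewrite e0 eqxx.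
Qed.

Section Homogeneous.
Context {K : fieldType}.
Implicit Types (f : {mpoly K[3]}).

Lemma mcoeff_pihomog d f m :
  (pihomog mdeg d f)@_m = f@_m *+ (mdeg m == d).
Proof.
rewrite pihomogE raddf_sum big_mkcond [in RHS](mpolyE f) raddf_sum /= -sumrMnl.
apply: eq_bigr => k _; rewrite !mcoeffZ mcoeffX.
have [->|_] := eqVneq k m; first by case: (_ == d).
by rewrite mulr0 mul0rn if_same.
Qed.

Lemma dhomog_shear a b d f : f \is d.-homog -> shear a b f \is d.-homog.
Proof.
move=> /dhomogP hom_f; rewrite /shear comp_mpolyEX big_seq; apply: rpred_sum => m.
move=> /hom_f <-; apply: rpredZ; rewrite comp_mpolyX big_I3 !(tnth_nth 0) /= mdeg3.
have homX i : ('X_i : {mpoly K[3]}) \is 1.-homog by rewrite dhomogX /= mdeg1.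
by do !apply: dhomogM; rewrite -[X in X.-homog]mul1n; apply: dhomogMn;
  rewrite ?(rpredD, rpredZ, homX).
Qed.

Lemma pihomog_shear a b d f :
  pihomog mdeg d (shear a b f) = shear a b (pihomog mdeg d f).
Proof.
rewrite /shear; elim/mpolyind: f => [|c m f _ _ IHf].
  by rewrite comp_mpoly0 pihomog0 comp_mpoly0.
rewrite comp_mpolyD !pihomogD IHf comp_mpolyD; congr (_ + _).
rewrite comp_mpolyZ !linearZ /= pihomogX; congr (_ *: _).
have hom_m : ('X_[m] : {mpoly K[3]}) \is (mdeg m).-homog by rewrite dhomogX.
have := dhomog_shear a b hom_m; rewrite /shear => hom_s.
have [eq_d|ne_d] := eqVneq (mdeg m) d; first by rewrite pihomog_dE -?eq_d.
by rewrite comp_mpoly0 (pihomog_ne0 ne_d hom_s).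
Qed.

End Homogeneous.

(** * Division by a form that is monic in z *)

Section Division.
Context {K : fieldType}.
Local Notation S := {mpoly K[3]}.
Implicit Types (f h N Q R : S).

Definition zdeg_lt n f := forall m, m \in msupp f -> (m 2%:R < n)%N.

(** [f] as a polynomial in z; its coefficients, which involve only x and y, are kept in [S] so that
    evaluation at z gives [f] back. *)
Definition zpoly f : {poly S} :=
  mmap (polyC \o @mpolyC 3 K) (tnth [tuple ('X_0 : S)%:P; ('X_1)%:P; 'X]) f.

Lemma zpolyD f h : zpoly (f + h) = zpoly f + zpoly h.
Proof. exact: mmapD. Qed.

Lemma zpolyB f h : zpoly (f - h) = zpoly f - zpoly h.
Proof. exact: mmapB. Qed.

Lemma zpolyM f h : zpoly (f * h) = zpoly f * zpoly h.
Proof. exact: rmorphM. Qed.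

Lemma zpolyK f : (zpoly f).['X_2%:R] = f.
Proof.
rewrite /zpoly /mmap horner_sum [RHS](mpolyE f); apply: eq_bigr => m _.
rewrite /mmap1 hornerCM mul_mpolyC big_I3 !(tnth_nth 0) [in RHS]mpolyXE_id big_I3.
by rewrite /= -!polyC_exp 2!hornerM !hornerC hornerXn.
Qed.

(** The shear changes z only by a form in x and y, so the degree in z does not grow. *)
Lemma size_zpoly_shear a b n f : zdeg_lt n f -> (size (zpoly (shear a b f)) <= n)%N.
Proof.
move=> lt_f; rewrite /shear comp_mpolyEX /zpoly raddf_sum /= big_seq.
apply: (leq_trans (size_sum _ _ _)); apply/bigmax_leqP_seq => m supp_m _.
rewrite mmapZ comp_mpolyX big_I3 !(tnth_nth 0) /= !rmorphM !rmorphXn /= !rmorphD /=.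
rewrite !mmapZ !mmapX !mmap1U !(tnth_nth 0) /= -!polyCM -addrA -!polyCD.
rewrite -!polyC_exp !mul_polyC.
do 3!apply: (leq_trans (size_scale_leq _ _)).
by rewrite (leq_trans (size_poly_exp_leq _ _)) // size_XaddC mul1n lt_f.
Qed.

Lemma size_zpoly_sub_shear a b n f :
  zdeg_lt n f -> (size (zpoly (f - shear a b f)) <= n)%N.
Proof.
move=> lt_f; have le_0 := size_zpoly_shear 0 0 lt_f; rewrite shear0 in le_0.
have le_s := size_zpoly_shear a b lt_f.
rewrite zpolyB; apply: leq_trans (size_polyD _ _) _.
by rewrite geq_max size_polyN; apply/andP.
Qed.

Variables (n : nat) (N : S).
Hypothesis N_lead : has_lead N (U_(2%:R) *+ n) 1.
Hypothesis N_homog : N \is n.-homog.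

(** Among the monomials of degree [n], only [z^n] has z-exponent [n]. *)
Lemma monic_tail_zdeg_lt : zdeg_lt n (N - 'X_2%:R ^+ n).
Proof.
move=> m supp_m; have hom : N - 'X_2%:R ^+ n \is n.-homog.
  by rewrite rpredB // mpolyXn dhomogX /= mdegMn mdeg1 mul1n.
have /dhomogP/(_ m supp_m) := hom; rewrite /= mdeg3 => deg_m.
rewrite ltn_neqAle; apply/andP; split; last by lia.
apply: contraTneq supp_m => m2.
have -> : m = (U_(2%:R) *+ n)%MM.
  by apply: mnm3P; rewrite mulmnE mnm1E ?m2 /= ?mul0n ?mul1n //; lia.
by rewrite mcoeff_msupp mcoeffB (proj2 N_lead) mpolyXn mcoeffX eqxx subrr eqxx.
Qed.

Lemma monic_division d f : f \is d.-homog ->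
  exists Q R, [/\ f = Q * N + R, R \is d.-homog & zdeg_lt n R].
Proof.
move=> /dhomogP hom_f; rewrite (mpolyE f) big_seq.
pose P g := exists Q R, [/\ g = Q * N + R, R \is d.-homog & zdeg_lt n R].
have addP g h : P g -> P h -> P (g + h).
  move=> [Q1 [R1 [-> h1 z1]]] [Q2 [R2 [-> h2 z2]]].
  exists (Q1 + Q2), (R1 + R2); split; [ring|exact: rpredD|].
  by move=> m /msuppD_le; rewrite mem_cat => /orP[/z1|/z2].
have scaleP c g : P g -> P (c *: g).
  move=> [Q1 [R1 [-> h1 z1]]]; exists (c *: Q1), (c *: R1); split.
  - by rewrite scalerDr scalerAl.
  - exact: rpredZ.
  by move=> m /msuppZ_le /z1.
have P0 : P 0.
  by exists 0, 0; split; rewrite ?mul0r ?addr0 ?rpred0 // => m; rewrite msupp0.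
have sumP (r : seq 'X_{1..3}) (c : 'X_{1..3} -> K) (F : 'X_{1..3} -> S) :
    (forall m, m \in r -> P (F m)) -> P (\sum_(m <- r | m \in r) c m *: F m).
  by move=> PF; apply: big_ind => // m /PF PFm; apply: scaleP.
have PX k (m : 'X_{1..3}) : (m 2%:R%R < k)%N -> mdeg m = d -> P 'X_[m].
  elim: k m => // k IHk m lt_m deg_m; have [lt_n|le_n] := ltnP (m 2%:R) n.
    exists 0, 'X_[m]; rewrite mul0r add0r dhomogX /= deg_m eqxx; split=> //.
    by move=> m'; rewrite msuppX inE => /eqP->.
  pose m1 := (m - U_(2%:R) *+ n)%MM.
  have def_m : m = (m1 + U_(2%:R) *+ n)%MM.
    by apply: mnm3P; rewrite !(mnmDE, mnmBE, mulmnE, mnm1E) /= ?mul1n ?subnK // subn0 addn0.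
  (* Trades [z^n] for the tail of [N], which has smaller degree in z. *)
  have defX : 'X_[m] = 'X_[m1] * N - 'X_[m1] * (N - 'X_2%:R ^+ n) :> S.
    by rewrite {1}def_m mpolyXD -mpolyXn; ring.
  rewrite defX; apply: addP.
    exists 'X_[m1], 0; rewrite addr0 rpred0; split=> // m'.
    by rewrite msupp0.
  rewrite -scaleN1r; apply: scaleP; rewrite (mpolyE (N - _)) big_seq mulr_sumr.
  under eq_bigr => m2 _ do rewrite -scalerAr -mpolyXD.
  apply: (sumP _ _ (fun m2 => 'X_[m1 + m2])) => m2 supp_m2.
  have lt_m2 := monic_tail_zdeg_lt supp_m2.
  have hom : N - 'X_2%:R ^+ n \is n.-homog.
    by rewrite rpredB // mpolyXn dhomogX /= mdegMn mdeg1 mul1n.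
  have /dhomogP/(_ m2 supp_m2) /= deg_m2 := hom.
  apply: IHk; rewrite ?mdegD ?deg_m2 -?deg_m ?[m in RHS]def_m ?mdegD ?mdegMn ?mdeg1 ?mul1n //.
  by move: lt_m; rewrite def_m !mnmDE mulmnE mnm1E /= mul1n; lia.
by apply: (sumP _ _ (fun m => 'X_[m])) => m /hom_f; apply: PX (ltnSn _).
Qed.

(** A nonzero multiple of [N] has degree at least [n] in z. It serves to show that quotients of
    invariants are invariant, with [R] the difference of a remainder and its shear. *)
Lemma monic_division_unique Q R : (size (zpoly R) <= n)%N -> Q * N = R -> Q = 0.
Proof.
move=> le_R /(congr1 zpoly); rewrite zpolyM => eqQ.
have size_N' := size_zpoly_shear 0 0 monic_tail_zdeg_lt; rewrite shear0 in size_N'.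
have defN : zpoly N = 'X^n + zpoly (N - 'X_2%:R ^+ n).
  have zX : zpoly ('X_2%:R ^+ n) = 'X^n.
    by rewrite /zpoly rmorphXn /= mmapX mmap1U (tnth_nth 0).
  rewrite -zX -zpolyD; congr zpoly; ring.
have monN : zpoly N \is monic.
  by rewrite monicE defN lead_coefDl ?lead_coefXn // size_polyXn ltnS.
have sizeN : size (zpoly N) = n.+1.
  by rewrite defN size_polyDl size_polyXn // ltnS.
have [Q0|nz_Q] := eqVneq (zpoly Q) 0; first by rewrite -(zpolyK Q) Q0 horner0.
have size_R := size_Mmonic nz_Q monN; rewrite eqQ in size_R.
have pos_Q : (0 < size (zpoly Q))%N by rewrite size_poly_gt0.
have add_pred a b k : (0 < a)%N -> b = k.+1 -> (k < (a + b).-1)%N.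
  by move=> a_gt0 ->; rewrite addnS /= -[X in (X < _)%N]add0n ltn_add2r.
by have := add_pred _ _ _ pos_Q sizeN; rewrite -size_R ltnNge le_R.
Qed.

End Division.

(** * The minors *)

(** The 3 by 3 determinant with the given rows, as an explicit polynomial on which [ring] can
    work. *)
Definition det3 (R : comNzRingType) (r1 r2 r3 : 'I_3 -> R) : R :=
  r1 0 * (r2 1 * r3 2%:R - r2 2%:R * r3 1)
  - r1 1 * (r2 0 * r3 2%:R - r2 2%:R * r3 0)
  + r1 2%:R * (r2 0 * r3 1 - r2 1 * r3 0).

Section Det3.
Context {R : comNzRingType}.
Implicit Types (r : 'I_3 -> R).

Lemma det_mx2 (M : 'M[R]_2) : \det M = M 0 0 * M 1 1 - M 0 1 * M 1 0.
Proof.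
have e1 : lift 0 (0 : 'I_1) = 1 :> 'I_2 by apply: val_inj.
have e2 : lift 1 (0 : 'I_1) = 0 :> 'I_2 by apply: val_inj.
rewrite (expand_det_row _ 0) !big_ord_recl big_ord0 /cofactor !det_mx11 !mxE.
by rewrite !(e1, e2) /= !(expr0, expr1); ring.
Qed.

Lemma det_mx3 (M : 'M[R]_3) : \det M = det3 (M 0) (M 1) (M 2%:R).
Proof.
have e1 : lift 0 (0 : 'I_2) = 1 :> 'I_3 by apply: val_inj.
have e2 : lift 0 (1 : 'I_2) = 2%:R :> 'I_3 by apply: val_inj.
have e3 : lift 1 (0 : 'I_2) = 0 :> 'I_3 by apply: val_inj.
have e4 : lift 1 (1 : 'I_2) = 2%:R :> 'I_3 by apply: val_inj.
have e5 : lift 2%:R (0 : 'I_2) = 0 :> 'I_3 by apply: val_inj.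
have e6 : lift 2%:R (1 : 'I_2) = 1 :> 'I_3 by apply: val_inj.
rewrite (expand_det_row _ 0) big_I3 /cofactor !det_mx2 !mxE.
rewrite !(e1, e2, e3, e4, e5, e6) /det3 /=.
by rewrite !(expr0, expr1, expr2); ring.
Qed.

(* Laplace expansion of a 4 x 4 determinant with two equal columns. *)
Lemma det3_expand_repeated r1 r2 r3 r4 i :
  det3 r1 r2 r3 * r4 i - det3 r1 r2 r4 * r3 i
  + det3 r1 r3 r4 * r2 i - det3 r2 r3 r4 * r1 i = 0.
Proof. by elim/forall_I3: i; rewrite /det3; ring. Qed.

Lemma rmorph_det3 (S : comNzRingType) (f : {rmorphism R -> S}) r1 r2 r3 :
  f (det3 r1 r2 r3) = det3 (f \o r1) (f \o r2) (f \o r3).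
Proof. by rewrite /det3 /= rmorphD rmorphB !rmorphM !rmorphB !rmorphM. Qed.

Lemma eq_det3 r1 r2 r3 s1 s2 s3 : r1 =1 s1 -> r2 =1 s2 -> r3 =1 s3 ->
  det3 r1 r2 r3 = det3 s1 s2 s3.
Proof. by move=> e1 e2 e3; rewrite /det3 !e1 !e2 !e3. Qed.

End Det3.

Section Gamma.
Context {K : fieldType} (p : nat) (X : 'M[K]_(2, 3)).

Definition gamma_row (r : nat) (c : 'I_3) : K :=
  X (inord (r.-1 %% 2)) c ^+ (p ^ (r.-1 %/ 2)).

Lemma gammaE i j k : (i <= 5)%N -> (j <= 5)%N -> (k <= 5)%N ->
  gamma p X i j k = det3 (gamma_row i) (gamma_row j) (gamma_row k).
Proof.
move=> le_i le_j le_k; rewrite /gamma det_mx3 /det3 !mxE /= !inordK; try lia.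
by [].
Qed.

Lemma gamma_row1 c : gamma_row 1 c = X 0 c.
Proof. by rewrite /gamma_row expr1; congr (X _ _); apply: val_inj; rewrite /= inordK. Qed.
Lemma gamma_row2 c : gamma_row 2 c = X 1 c.
Proof. by rewrite /gamma_row expr1; congr (X _ _); apply: val_inj; rewrite /= inordK. Qed.
Lemma gamma_row3 c : gamma_row 3 c = X 0 c ^+ p.
Proof. by rewrite /gamma_row expn1; congr (X _ _ ^+ _); apply: val_inj; rewrite /= inordK. Qed.
Lemma gamma_row4 c : gamma_row 4 c = X 1 c ^+ p.
Proof. by rewrite /gamma_row expn1; congr (X _ _ ^+ _); apply: val_inj; rewrite /= inordK. Qed.
Lemma gamma_row5 c : gamma_row 5 c = X 0 c ^+ (p ^ 2).
Proof. by rewrite /gamma_row; congr (X _ _ ^+ _); apply: val_inj; rewrite /= inordK. Qed.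

End Gamma.

(** * Shears of the generators *)

Lemma double_lt_sqr p : (2 < p)%N -> (2 * p < p ^ 2)%N.
Proof. by move=> p_gt2; rewrite -mulnn ltn_mul2r p_gt2; lia. Qed.

Section Frobenius.
Context {R : comNzRingType} {p : nat}.
Hypothesis pcharR : p \in [pchar R].

Lemma pnat_pchar_exp n : [pchar R].-nat (p ^ n)%N.
Proof.
rewrite pnatX; apply/orP; left.
by rewrite (eq_pnat _ (GRing.pcharf_eq pcharR)) pnat_id // (pcharf_prime pcharR).
Qed.

Lemma exprD_pchar n (u v : R) : (u + v) ^+ (p ^ n) = u ^+ (p ^ n) + v ^+ (p ^ n).
Proof. exact: exprDn_pchar (pnat_pchar_exp n). Qed.

Lemma exprB_pchar n (u v : R) : (u - v) ^+ (p ^ n) = u ^+ (p ^ n) - v ^+ (p ^ n).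
Proof. by rewrite exprD_pchar (GRing.exprNn_pchar _ (pnat_pchar_exp n)). Qed.

End Frobenius.

Section ShearInvariance.
Context {K : fieldType}.
Implicit Types (a b : K) (f g : {mpoly K[3]}).

Lemma shearM a b f g : shear a b (f * g) = shear a b f * shear a b g.
Proof. exact: rmorphM. Qed.
Lemma shearXn a b f k : shear a b (f ^+ k) = shear a b f ^+ k.
Proof. exact: rmorphXn. Qed.
Lemma shear_add a b f g : shear a b (f + g) = shear a b f + shear a b g.
Proof. exact: comp_mpolyD. Qed.
Lemma shear_sub a b f g : shear a b (f - g) = shear a b f - shear a b g.
Proof. exact: comp_mpolyB. Qed.
Lemma shear_opp a b f : shear a b (- f) = - shear a b f.
Proof. exact: comp_mpolyN. Qed.
Lemma shearZ a b c f : shear a b (c *: f) = c *: shear a b f.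
Proof. exact: comp_mpolyZ. Qed.
Definition shearE := (shear_add, shear_sub, shear_opp, shearM, shearXn, shearZ,
  @shearX0 K, @shearX1 K, @shearX2 K).

Lemma shear_delta a b : shear a b delta = delta - b *: 'X_0 ^+ 2.
Proof.
rewrite /delta !shearE -!mul_mpolyC mpolyCD rmorphXn mpolyCM /= mpolyC_nat.
ring.
Qed.

End ShearInvariance.

(** * Invariance, degrees and shape of f1, f2 and the numerator of f3 *)

Section Generators.
Context {K : fieldType} (p : nat) (X : 'M[K]_(2, 3)).
Hypothesis pcharK : p \in [pchar K].
Hypothesis p_gt2 : (2 < p)%N.

Local Notation S := {mpoly K[3]}.
Local Notation x := ('X_0 : S).
Local Notation y := ('X_1 : S).
Local Notation z := ('X_2%:R : S).
Local Notation gam := (gamma p X).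
Local Notation s := (x ^+ (p - 2)).
Local Notation t := (x ^+ (p ^ 2 - p)).

Lemma pchar_mpoly : p \in [pchar S].
Proof. exact: (rmorph_pchar (@mpolyC 3 K)). Qed.

(** Powers of x whose exponents depend on [p] are written through [s] and [t], which [ring] then
    treats as atoms. *)
Lemma xp : x ^+ p = s * x ^+ 2.
Proof. by rewrite -exprD subnK // ltnW. Qed.

Lemma x2p2 : x ^+ (2 * p - 2) = s ^+ 2 * x ^+ 2.
Proof. by rewrite -exprM -exprD; congr (_ ^+ _); lia. Qed.

Lemma x2p1 : x ^+ (2 * p - 1) = s ^+ 2 * x ^+ 3.
Proof. by rewrite -exprM -exprD; congr (_ ^+ _); lia. Qed.

Lemma xpp2 : x ^+ (p ^ 2 - 2) = t * s.
Proof. by have := double_lt_sqr p_gt2; rewrite -exprD => ?; congr (_ ^+ _); lia. Qed.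

Lemma xpp1 : x ^+ (p ^ 2 - 1) = t * s * x.
Proof. by have := double_lt_sqr p_gt2; rewrite -!exprD -exprSr => ?; congr (_ ^+ _); lia. Qed.

Lemma xpp : x ^+ (p ^ 2) = t * s * x ^+ 2.
Proof. by have := double_lt_sqr p_gt2; rewrite -!exprD => ?; congr (_ ^+ _); lia. Qed.

(** The change of [f1] under the shear is [x^(2p)] times the expansion of a vanishing 4 by 4
    determinant: rows 1, 2, 3, 4 of the matrix, with column [i] repeated. *)
Lemma shear_gen_f1 i : rep_gen X i (f1 p X) = f1 p X.
Proof.
set a := X 0 i; set b := X 1 i.
have /(congr1 (@mpolyC 3 K)) := det3_expand_repeated
  (gamma_row p X 1) (gamma_row p X 2) (gamma_row p X 3) (gamma_row p X 4) i.
rewrite gamma_row1 gamma_row2 gamma_row3 gamma_row4 -!gammaE //.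
rewrite -/a -/b mpolyC0 !(mpolyCD, mpolyCN) !mpolyCM !rmorphXn /= => rel.
rewrite /rep_gen -/a -/b /f1; have := shear_delta a b; move: delta => D shearD.
rewrite !shearE shearD.
have := exprB_pchar pchar_mpoly 1 D (b *: x ^+ 2).
have := exprD_pchar pchar_mpoly 1 y (a *: x).
rewrite !expn1 => -> ->; rewrite -!mul_mpolyC !exprMn.
rewrite x2p2 x2p1 xp; move: s rel => s rel.
apply/eqP; rewrite -subr_eq0; apply/eqP.
by rewrite -[RHS](mul0r (s ^+ 2 * x ^+ 4)) -rel; ring.
Qed.

(** As for [f1], with rows 1, 2, 3, 5 and the factor [x^(p^2)]. *)
Lemma shear_gen_f2 i : rep_gen X i (f2 p X) = f2 p X.
Proof.
set a := X 0 i; set b := X 1 i.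
have /(congr1 (@mpolyC 3 K)) := det3_expand_repeated
  (gamma_row p X 1) (gamma_row p X 2) (gamma_row p X 3) (gamma_row p X 5) i.
rewrite gamma_row1 gamma_row2 gamma_row3 gamma_row5 -!gammaE //.
rewrite -/a -/b mpolyC0 !(mpolyCD, mpolyCN) !mpolyCM !rmorphXn /= => rel.
rewrite /rep_gen -/a -/b /f2; have := shear_delta a b; move: delta => D shearD.
rewrite !shearE shearD.
have := exprD_pchar pchar_mpoly 2 y (a *: x).
have := exprD_pchar pchar_mpoly 1 y (a *: x).
rewrite !expn1 => -> ->; rewrite -!mul_mpolyC !exprMn.
rewrite xpp2 xpp1 xpp xp; move: s t rel => s t rel.
apply/eqP; rewrite -subr_eq0; apply/eqP.
by rewrite -[RHS](mul0r (t * s * x ^+ 2)) -rel; ring.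
Qed.

Lemma homogX i k : ('X_i ^+ k : S) \is k.-homog.
Proof. by rewrite mpolyXn dhomogX /= mdegMn mdeg1 mul1n. Qed.

Lemma homogX1 i : ('X_i : S) \is 1.-homog.
Proof. exact: (homogX i 1). Qed.

Lemma homog_delta : (delta : S) \is 2.-homog.
Proof.
by rewrite /delta rpredB ?homogX //; apply: (dhomogM (homogX1 _) (homogX1 _)).
Qed.

Lemma dhomogM_eq d e n (u v : S) : u \is d.-homog -> v \is e.-homog ->
  (d + e = n)%N -> u * v \is n.-homog.
Proof. by move=> hom_u hom_v <-; apply: dhomogM. Qed.

Lemma homog_f1 : f1 p X \is (2 * p).-homog.
Proof.
rewrite /f1 !rpredB ?rpredN // rpredZ //.
- exact/dhomogMn/homog_delta.
- by apply: dhomogM_eq (homogX _ _) (homogX _ _) _; lia.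
- by apply: dhomogM_eq homog_delta (homogX _ _) _; lia.
by apply: dhomogM_eq (homogX1 _) (homogX _ _) _; lia.
Qed.

Lemma homog_f2 : f2 p X \is (p ^ 2).-homog.
Proof.
have lt_p2 := double_lt_sqr p_gt2.
rewrite /f2 !rpredB // rpredZ ?homogX //.
- by apply: dhomogM_eq (homogX _ _) (homogX _ _) _; lia.
- by apply: dhomogM_eq homog_delta (homogX _ _) _; lia.
by apply: dhomogM_eq (homogX1 _) (homogX _ _) _; lia.
Qed.

Hypothesis p_odd : odd p.

Lemma half_p1 : ((p + 1)./2 * 2 = p + 1)%N.
Proof. by rewrite muln2 even_halfK // oddD p_odd. Qed.

Lemma homog_f3_num : f3_num p X \is (2 * p ^ 2).-homog.
Proof.
have lt_p2 := double_lt_sqr p_gt2.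
rewrite /f3_num !rpredD // ?rpredZ //.
- have -> : (2 * p ^ 2 = 2 * p * p)%N by lia.
  exact/dhomogMn/homog_f1.
- by rewrite mulnC; apply/dhomogMn/homog_f2.
apply: dhomogM_eq (homogX _ _) (dhomogMn _ homog_f1) _.
by have := half_p1; nia.
Qed.

Local Notation g := (gam 1 2 3).

(** The p-th power of the tail is divisible by [x^(p^2)], more than the [x^(p^2 - 2)] divided out in
    [f3]. *)
Lemma f1_tail : exists E, f1 p X = - g *: y ^+ (2 * p) + x ^+ p * E.
Proof.
exists (g *: z ^+ p - gam 1 2 4 *: y ^+ p - gam 1 3 4 *: (delta * s)
        - gam 2 3 4 *: (y * s * x)).
have delta_p : delta ^+ p = y ^+ (2 * p) - x ^+ p * z ^+ p.
  have := exprB_pchar pchar_mpoly 1 (y ^+ 2) (x * z).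
  by rewrite !expn1 [(x * z) ^+ p]exprMn -exprM.
rewrite /f1 delta_p x2p2 x2p1 scaleNr -!mul_mpolyC xp.
by move: s delta; move=> s d; ring.
Qed.

Lemma f2_tail : f2 p X = g *: y ^+ (p ^ 2) - gam 1 2 5 *: (y ^+ p * t)
  - t * s * (gam 1 3 5 *: delta + gam 2 3 5 *: (y * x)).
Proof. by rewrite /f2 xpp2 xpp1 -!mul_mpolyC; move: s t => s t; ring. Qed.

Lemma binomial_tail (u v : S) k : exists E, (u + v) ^+ k = u ^+ k + v * E.
Proof.
elim: k => [|k [E IHk]]; first by exists 0; rewrite !expr0 mulr0 addr0.
by exists ((u + v) * E + u ^+ k); rewrite !exprS IHk; ring.
Qed.

(** In the numerator, [y^(2p^2)] cancels between [f1^p] and [g^(p - 2) f2^2]; the cross term of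
    [f2^2] in [y^(p^2 + p) t] cancels against the third summand. The cross term of [g y^(p^2)] with
    the [delta] term of [f2] then leaves [y^(p^2 + 2) x^(p^2 - 2)], and all other terms are
    divisible by [x^(p^2 - 1)]. *)
Lemma f3_num_tail : exists R, f3_num p X =
  ((- 2%:R * g ^+ (p - 1) * gam 1 3 5) *: y ^+ (p ^ 2 + 2) + x * R)
   * x ^+ (p ^ 2 - 2).
Proof.
have [E1 def_f1] := f1_tail.
have [E2 def_E2] := binomial_tail (- g *: y ^+ (2 * p)) (x ^+ p * E1) (p + 1)./2.
have half1 := half_p1.
have half3 : ((p - 3)./2 * 2 = p - 3)%N by rewrite muln2 even_halfK // oddB // p_odd.
have f1p : f1 p X ^+ p = - (g ^+ p *: y ^+ (p ^ 2) ^+ 2) + x ^+ (p ^ 2) * E1 ^+ p.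
  rewrite def_f1 -[in X in _ ^+ X](expn1 p) (exprD_pchar pchar_mpoly) expn1.
  rewrite exprMn -!exprM exprZn -exprM (GRing.exprNn_pchar g); last first.
    by have := pnat_pchar_exp pcharK 1; rewrite expn1.
  by rewrite scaleNr; congr (- (_ *: y ^+ _) + x ^+ _ * _); lia.
have f1h : f1 p X ^+ (p + 1)./2
    = (- g) ^+ (p + 1)./2 *: (y ^+ (p ^ 2) * y ^+ p) + x ^+ p * (E1 * E2).
  rewrite def_f1 def_E2 exprZn -exprM -exprD mulrA.
  by congr (_ *: y ^+ _ + _); nia.
(* The exponents add up to [p - 1], which is even, so the sign disappears. *)
have signs : (- g) ^+ (p - 3)./2 * (- g) ^+ (p + 1)./2 = g ^+ (p - 2) * g.
  rewrite -exprD -exprSr (_ : (p - 3)./2 + (p + 1)./2 = p - 1)%N; last by lia.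
  rewrite exprNn -signr_odd oddB ?p_odd; last by lia.
  by rewrite mul1r; congr (_ ^+ _); lia.
have gp : g ^+ p = g ^+ (p - 2) * g ^+ 2 by rewrite -exprD subnK // ltnW.
have gp1 : g ^+ (p - 1) = g ^+ (p - 2) * g by rewrite -exprSr; congr (_ ^+ _); lia.
(* Makes [t ^+ 2] a multiple of [t * s * x], which is [x^(p^2 - 1)]. *)
have def_t : t = s * x * x ^+ (p ^ 2 - 2 * p + 1).
  by have := double_lt_sqr p_gt2; rewrite -exprSr -exprD => ?; congr (_ ^+ _); lia.
rewrite /f3_num f1p f1h f2_tail xpp xp xpp2 gp gp1 exprD.
move: signs; set A := (- g) ^+ (p - 3)./2; set B := (- g) ^+ (p + 1)./2.
set c := g ^+ (p - 2); set r := x ^+ (p ^ 2 - 2 * p + 1) in def_t.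
set E3 := gam 1 3 5 *: delta + gam 2 3 5 *: (y * x).
move/(congr1 (@mpolyC 3 K)); rewrite !mpolyCM => signs.
(* In order: the tail of [f1^p], the square of the tail of [f2], the tail of the third summand, and
   the part of the last cross term with a further factor x. *)
exists (x * E1 ^+ p + c *: (gam 1 2 5 ^+ 2 *: ((y ^+ p) ^+ 2 * r) + s ^+ 2 * r * E3 ^+ 2
          + (2%:R * gam 1 2 5) *: (y ^+ p * s * r * E3))
        + (2%:R * A * gam 1 2 5) *: (x * (E1 * E2))
        - (2%:R * c * g) *: (y ^+ (p ^ 2) * (gam 2 3 5 *: y - gam 1 3 5 *: z))).
clearbody r A B c.
rewrite {}/E3 /delta -!mul_mpolyC !rmorphM ?rmorphXn !rmorphN !rmorph_nat /=.
move: (y ^+ (p ^ 2)) (y ^+ p) (E1 ^+ p) => Y w E1p.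
have rel : A%:MP * B%:MP - c%:MP * g%:MP = 0 :> S by rewrite signs subrr.
rewrite def_t; move: s => s.
apply/eqP; rewrite -subr_eq0; apply/eqP.
rewrite -[RHS](mul0r (2%:R * (gam 1 2 5)%:MP * s * x * r * Y * w)) -rel.
ring.
Qed.
End Generators.

(** * Invariance and leading monomials of the generators *)

Section Tail.
Context {K : fieldType}.
Local Notation S := {mpoly K[3]}.
Implicit Types (f R : S).

Lemma dhomog_divX (i : 'I_3) k d f :
  f * 'X_i ^+ k \is (d + k).-homog -> f \is d.-homog.
Proof.
move=> /dhomogP hom; apply/dhomogP => m supp_m.
have := hom (U_(i) *+ k + m)%MM; rewrite mpolyXn (perm_mem (msuppMX _ _)).
rewrite map_f // => /(_ isT); rewrite /= mdegD mdegMn mdeg1; lia.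
Qed.

(** As x is the smallest variable, every multiple of x of degree [d] lies below [y^d]. *)
Lemma has_lead_tail d (c : K) f R : f \is d.-homog ->
  f = c *: 'X_1 ^+ d + 'X_0 * R -> has_lead f (U_(1) *+ d) c.
Proof.
move=> hom_f def_f; have supp_xR m : m \in msupp ('X_0 * R) -> (0 < m 0%R)%N.
  rewrite mulrC (perm_mem (msuppMX _ _)) => /mapP[k _ ->].
  by rewrite mnmDE mnm1E.
split=> [m supp_m|]; last first.
  rewrite def_f mcoeffD mcoeffZ mpolyXn mcoeffX eqxx mulr1 memN_msupp_eq0 ?addr0 //.
  by apply/negP => /supp_xR; rewrite mulmnE mnm1E.
have /dhomogP/(_ m supp_m) /= deg_m := hom_f.
move: supp_m; rewrite def_f => /msuppD_le; rewrite mem_cat => /orP[|/supp_xR gt0].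
  by move/msuppZ_le; rewrite mpolyXn msuppX inE => /eqP->; apply: grevlex_refl.
by rewrite grevlex3 ?mdegMn ?mdeg1 ?mul1n // mulmnE mnm1E gt0.
Qed.

End Tail.

Section InvariantRing.
Context {K : fieldType} (p : nat) (X : 'M[K]_(2, 3)).
Hypothesis pcharK : p \in [pchar K].
Hypothesis p_gt2 : (2 < p)%N.

Local Notation S := {mpoly K[3]}.
Local Notation x := ('X_0 : S).
Local Notation y := ('X_1 : S).
Local Notation z := ('X_2%:R : S).
Local Notation V := 'rV['F_p]_3.
Local Notation inv := (in_invariant_ring p X).
Implicit Types (f h : S).

Lemma inv_rep_gen f : (forall i, rep_gen X i f = f) -> inv f.
Proof. by move=> fix_f g; rewrite /rep_act !iter_fix. Qed.

Lemma inv_shear f (g : V) : inv f -> shear (lin X 0 g) (lin X 1 g) f = f.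
Proof. by move=> inv_f; rewrite -(rep_act_shear X g f). Qed.

Lemma shear_inv f : (forall g : V, shear (lin X 0 g) (lin X 1 g) f = f) -> inv f.
Proof. by move=> fix_f g; rewrite rep_act_shear. Qed.

Lemma inv_comp m (B : m.-tuple S) P : (forall i, inv (tnth B i)) -> inv (P \mPo B).
Proof.
move=> inv_B; apply: shear_inv => g; rewrite /shear comp_mpolyA.
congr (_ \mPo _); apply: eq_from_tnth => i; rewrite tnth_map.
exact: (inv_shear g (inv_B i)).
Qed.

Lemma invD f h : inv f -> inv h -> inv (f + h).
Proof. by move=> inv_f inv_h; apply: shear_inv => g; rewrite shear_add !inv_shear. Qed.

Lemma invZ c f : inv f -> inv (c *: f).
Proof. by move=> inv_f; apply: shear_inv => g; rewrite shearZ inv_shear. Qed.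

Lemma invM f h : inv f -> inv h -> inv (f * h).
Proof. by move=> inv_f inv_h; apply: shear_inv => g; rewrite shearM !inv_shear. Qed.

Lemma inv_exp f k : inv f -> inv (f ^+ k).
Proof. by move=> inv_f; apply: shear_inv => g; rewrite shearXn inv_shear. Qed.

Lemma invMl f h : h != 0 -> inv h -> inv (h * f) -> inv f.
Proof.
move=> nz_h inv_h inv_hf; apply: shear_inv => g; apply: (mulfI nz_h).
by rewrite -{1}(inv_shear g inv_h) -shearM inv_shear.
Qed.

Lemma inv_pihomog d f : inv f -> inv (pihomog mdeg d f).
Proof. by move=> inv_f; apply: shear_inv => g; rewrite -pihomog_shear inv_shear. Qed.

Lemma inv_x : inv x.
Proof. by apply: shear_inv => g; rewrite shearX0. Qed.

Lemma inv_f1 : inv (f1 p X).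
Proof. by apply: inv_rep_gen => i; apply: shear_gen_f1. Qed.

Lemma inv_f2 : inv (f2 p X).
Proof. by apply: inv_rep_gen => i; apply: shear_gen_f2. Qed.

Lemma p_odd : odd p.
Proof. by case: (even_prime (pcharf_prime pcharK)) p_gt2 => // ->. Qed.

Lemma inv_f3_num : inv (f3_num p X).
Proof.
apply: invD; [apply: invD|].
- exact/inv_exp/inv_f1.
- exact/invZ/inv_exp/inv_f2.
by apply/invZ/invM; apply: inv_exp; [apply: inv_x|apply: inv_f1].
Qed.

(** [f3_num_tail] shows that the division by [x^(p^2 - 2)] in [f3] is exact. *)
Lemma f3_numE : f3_num p X = (- 2%:R) *: (x ^+ (p ^ 2 - 2) * f3 p X).
Proof.
have [R def_f3] := f3_num_tail X pcharK p_gt2 p_odd.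
rewrite /f3 def_f3 divXK -scalerAr scalerA divff ?scale1r ?oppr_eq0 ?(two_neq0 pcharK p_gt2) //.
exact: mulrC.
Qed.

Lemma f3_tail : exists R, f3 p X =
  (gamma p X 1 2 3 ^+ (p - 1) * gamma p X 1 3 5) *: y ^+ (p ^ 2 + 2) + x * R.
Proof.
have [R def_f3] := f3_num_tail X pcharK p_gt2 p_odd.
exists ((- 2%:R)^-1 *: R); rewrite /f3 def_f3 divXK scalerDr scalerA scalerAr.
congr (_ *: _ + _); rewrite -mulrA mulKf // oppr_eq0; exact: two_neq0 pcharK p_gt2.
Qed.

Lemma homog_f3 : f3 p X \is (p ^ 2 + 2).-homog.
Proof.
apply: (@dhomog_divX _ 0 (p ^ 2 - 2)); rewrite mulrC.
have := homog_f3_num X pcharK p_gt2 p_odd; rewrite f3_numE => hom.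
have lt_p2 := double_lt_sqr p_gt2.
have -> : (p ^ 2 + 2 + (p ^ 2 - 2) = 2 * p ^ 2)%N by lia.
have nz2 : - 2%:R != 0 :> K by rewrite oppr_eq0; apply: two_neq0 pcharK p_gt2.
by have := rpredZ (- 2%:R)^-1 hom; rewrite scalerA mulVf // scale1r.
Qed.

Lemma inv_f3 : inv (f3 p X).
Proof.
apply: (@invMl _ (- 2%:R *: x ^+ (p ^ 2 - 2))).
- rewrite scaler_eq0 negb_or oppr_eq0 (two_neq0 pcharK p_gt2) //.
  by rewrite expf_neq0 // -msupp_eq0 msuppX.
- by apply: shear_inv => g; rewrite shearZ shearXn shearX0.
by rewrite -scalerAl -f3_numE; apply: inv_f3_num.
Qed.

Lemma has_lead_f1 : has_lead (f1 p X) (U_(1) *+ (2 * p)) (- gamma p X 1 2 3).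
Proof.
have [E def_f1] := f1_tail X pcharK p_gt2.
apply: (has_lead_tail (homog_f1 X pcharK p_gt2) (R := x ^+ p.-1 * E)).
by rewrite mulrA -exprS prednK //; apply: ltn_trans p_gt2.
Qed.

Lemma has_lead_f2 : has_lead (f2 p X) (U_(1) *+ (p ^ 2)) (gamma p X 1 2 3).
Proof.
have lt_p2 := double_lt_sqr p_gt2.
apply: (has_lead_tail (homog_f2 X pcharK p_gt2)
  (R := - (gamma p X 1 2 5 *: (y ^+ p * x ^+ (p ^ 2 - p).-1))
        - gamma p X 1 3 5 *: (delta * x ^+ (p ^ 2 - 2).-1)
        - gamma p X 2 3 5 *: (y * x ^+ (p ^ 2 - 1).-1))).
have xS k : (0 < k)%N -> x ^+ k = x * x ^+ k.-1 by case: k => // k _; rewrite exprS.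
rewrite /f2 (xS (p ^ 2 - p)%N) ?(xS (p ^ 2 - 2)%N) ?(xS (p ^ 2 - 1)%N); try lia.
rewrite -!mul_mpolyC; ring.
Qed.

Lemma has_lead_f3 : has_lead (f3 p X) (U_(1) *+ (p ^ 2 + 2))
  (gamma p X 1 2 3 ^+ (p - 1) * gamma p X 1 3 5).
Proof. by have [R def_f3] := f3_tail; apply: has_lead_tail homog_f3 def_f3. Qed.

Hypothesis lin0_inj : injective (lin (p := p) X 0).

(** The y-coefficients [2 lin 0 g] of the forms g.z are distinct, so the orbit of z has one element
    for each [g]. *)
Lemma normzE : normz p X = \prod_(g : V) rep_act X g z.
Proof.
rewrite /normz undup_id; first by rewrite big_image.
rewrite map_inj_uniq ?enum_uniq // => g h.
rewrite !rep_act_shear !shearX2 => /(congr1 (mcoeff U_(1))).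
rewrite !(mcoeffD, mcoeffZ, mcoeffXU) /= !(mulr0, addr0, add0r, mulr1).
by move/(mulfI (two_neq0 pcharK p_gt2))/lin0_inj.
Qed.

Lemma inv_normz : inv (normz p X).
Proof.
move=> h; rewrite normzE rep_act_shear /shear rmorph_prod /=.
rewrite [RHS](reindex_inj (addIr h)) /=; apply: eq_bigr => g _.
by rewrite (rep_actD _ _ _ _ pcharK) -[LHS](rep_act_shear X h).
Qed.

Lemma homog_normz : normz p X \is (p ^ 3).-homog.
Proof.
rewrite normzE -(card_V pcharK) cardE -big_enum.
elim: (enum _) => [|g r IHr]; first by rewrite big_nil dhomog1.
rewrite big_cons; apply: dhomogM_eq IHr (add1n _); rewrite rep_act_shear.
exact/dhomog_shear/homogX1.
Qed.

Lemma has_lead_normz : has_lead (normz p X) (U_(2%:R) *+ (p ^ 3)) 1.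
Proof.
have lead_z (g : V) : has_lead (rep_act X g z) U_(2%:R) 1.
  have low c (i : 'I_3) : (i < 2)%N -> has_lead (c *: 'X_i : S) U_(2%:R) 0.
    move=> lt_i; rewrite -(mulr0 c); apply: has_leadZ; split=> [m|].
      rewrite msuppX inE => /eqP->; rewrite grevlex3 ?mdeg1 // !mnm1E.
      by move: lt_i; elim/forall_I3: i.
    by rewrite mcoeffXU -val_eqE /= ltn_eqF.
  rewrite rep_act_shear shearX2 -[X in has_lead _ _ X]addr0 -[X in has_lead _ _ (X + _)]addr0.
  by apply: has_leadD; [apply: has_leadD; [apply: has_leadXm|apply: low]|apply: low].
have def_m : (U_(2%:R) *+ (p ^ 3) = \sum_(g : V) U_(2%:R) :> 'X_{1..3})%MM.
  by apply/mnmP => i; rewrite mnm_sumE sum_nat_const mulmnE (card_V pcharK) mulnC.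
have def_1 : 1 = \prod_(g : V) 1 :> K by rewrite big1.
by rewrite [X in has_lead _ _ X]def_1 normzE def_m; apply: has_lead_prod.
Qed.

End InvariantRing.

(** * Leading monomials of invariants *)

Section LeadOfInvariants.
Context {K : fieldType} (p : nat) (X : 'M[K]_(2, 3)).
Hypothesis pcharK : p \in [pchar K].
Hypothesis p_gt2 : (2 < p)%N.
Hypothesis gamma123_neq0 : gamma p X 1 2 3 != 0.
Hypothesis gamma135_neq0 : gamma p X 1 3 5 != 0.
Local Notation V := 'rV['F_p]_3.
Hypothesis lin0_inj : injective (lin (p := p) X 0).
Hypothesis node_inj : {in [pred g : V | g != 0] &, injective (node X)}.

Local Notation S := {mpoly K[3]}.
Local Notation x := ('X_0 : S).
Local Notation y := ('X_1 : S).
Local Notation z := ('X_2%:R : S).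
Local Notation inv := (in_invariant_ring p X).
Local Notation B := (gens p X).
Implicit Types (f h : S).

Lemma tnth_gens : [/\ tnth B 0 = x, tnth B 1 = f1 p X, tnth B 2%:R = f2 p X,
  tnth B 3%:R = f3 p X & tnth B 4%:R = normz p X].
Proof. by split; rewrite (tnth_nth 0). Qed.

Lemma forall_I5 (P : 'I_5 -> Prop) :
  P 0 -> P 1 -> P 2%:R -> P 3%:R -> P 4%:R -> forall i, P i.
Proof.
move=> P0 P1 P2 P3 P4 [[|[|[|[|[|//]]]]] lti];
  [move: P0|move: P1|move: P2|move: P3|move: P4];
by congr P; apply: val_inj.
Qed.

Definition gens_lead : 5.-tuple 'X_{1..3} :=
  [tuple U_(0%R)%MM; (U_(1%R) *+ (2 * p))%MM; (U_(1%R) *+ (p ^ 2))%MM;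
         (U_(1%R) *+ (p ^ 2 + 2))%MM; (U_(2%:R%R) *+ (p ^ 3))%MM].

Definition gens_lead_coef : 5.-tuple K :=
  [tuple 1; - gamma p X 1 2 3; gamma p X 1 2 3;
         gamma p X 1 2 3 ^+ (p - 1) * gamma p X 1 3 5; 1].

Lemma gens_lead_coef_neq0 i : tnth gens_lead_coef i != 0.
Proof.
by elim/forall_I5: i; rewrite (tnth_nth 0) /= ?oppr_eq0 ?oner_eq0 // mulf_neq0 ?expf_neq0.
Qed.

Lemma has_lead_gens_tnth i :
  has_lead (tnth B i) (tnth gens_lead i) (tnth gens_lead_coef i).
Proof.
elim/forall_I5: i; rewrite !(tnth_nth 0) /= ?(tnth_nth 0%MM) /=.
- exact: has_leadXm.
- exact: has_lead_f1.
- exact: has_lead_f2.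
- exact: has_lead_f3.
- exact: has_lead_normz.
Qed.

Lemma gens_neq0 i : tnth B i != 0.
Proof. exact: has_lead_neq0 (gens_lead_coef_neq0 i) (has_lead_gens_tnth i). Qed.

Lemma lead_mon_gens_tnth i : lead_mon (tnth B i) = tnth gens_lead i.
Proof. exact: lead_mon_has_lead (gens_lead_coef_neq0 i) (has_lead_gens_tnth i). Qed.

Lemma inv_gens i : inv (tnth B i).
Proof.
elim/forall_I5: i; rewrite !(tnth_nth 0) /=.
- exact: inv_x.
- exact: inv_f1.
- exact: inv_f2.
- exact: inv_f3.
- exact: inv_normz.
Qed.

Definition is_lead_exp m := exists I, m = lead_exp B I.

Lemma is_lead_expD m1 m2 : is_lead_exp m1 -> is_lead_exp m2 -> is_lead_exp (m1 + m2)%MM.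
Proof. by move=> [I ->] [J ->]; exists (I + J)%MM; rewrite lead_expD. Qed.

Lemma is_lead_exp_gen i k : is_lead_exp (tnth gens_lead i *+ k)%MM.
Proof.
by exists (U_(i) *+ k)%MM; rewrite lead_expMn ?lead_exp1 ?lead_mon_gens_tnth //; apply: gens_neq0.
Qed.

Lemma lead_mon_pow_y h d : inv h -> h \is d.-homog -> h != 0 ->
  lead_mon h = (U_(1) *+ d)%MM -> is_lead_exp (U_(1) *+ d)%MM.
Proof.
move=> inv_h hom_h nz_h lead_h.
have p_gt1 : (1 < p)%N by apply: ltnW.
have [i [j [k]]] := semigroup_symmetric d (p_odd pcharK p_gt2) p_gt1.
have def_m : (U_(1) *+ (2 * p * i + p ^ 2 * j + (p ^ 2 + 2) * k) =
    tnth gens_lead 1 *+ i + tnth gens_lead 2%:R *+ j + tnth gens_lead 3%:R *+ k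
    :> 'X_{1..3})%MM.
  by apply/mnmP => l; rewrite !(tnth_nth 0%MM) /= !(mnmDE, mulmnE); lia.
case=> [<-|def_d].
  by rewrite def_m; do !apply: is_lead_expD; apply: is_lead_exp_gen.
(* Here the complement [p^3 - 2 - d] is in the semigroup, and the corresponding product of
   generators lifts the lead monomial to [y^(p^3 - 2)]. *)
pose H := h * (f1 p X ^+ i * f2 p X ^+ j * f3 p X ^+ k).
have inv_H : inv H.
  apply: invM => //; do !apply: invM; apply: inv_exp.
  - exact: (inv_gens 1).
  - exact: (inv_gens 2%:R).
  - exact: (inv_gens 3%:R).
have hom_H : H \is (p ^ 3 - 2).-homog.
  rewrite -def_d; apply: dhomogM => //.
  apply: dhomogM; [apply: dhomogM|]; apply: dhomogMn.
  - exact: homog_f1.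
  - exact: homog_f2.
  - exact: homog_f3.
have lead_H : H@_(U_(1) *+ (p ^ 3 - 2)) != 0.
  have lead_h' := has_lead_lead_mon h; rewrite lead_h in lead_h'.
  have := has_leadM lead_h' (has_leadM (has_leadM
    (has_leadX i (has_lead_gens_tnth 1)) (has_leadX j (has_lead_gens_tnth 2%:R)))
    (has_leadX k (has_lead_gens_tnth 3%:R))).
  rewrite -def_m; have [_ -> -> -> _] := tnth_gens.
  have -> : (U_(1) *+ d + U_(1) *+ (2 * p * i + p ^ 2 * j + (p ^ 2 + 2) * k)
             = U_(1) *+ (p ^ 3 - 2) :> 'X_{1..3})%MM.
    by rewrite -def_d; apply/mnmP => l; rewrite !(mnmDE, mulmnE); lia.
  case=> _ ->; rewrite !mulf_neq0 ?expf_neq0 ?gens_lead_coef_neq0 //.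
  by rewrite -lead_h mcoeff_lead_eq0.
rewrite (residue_coef_eq0 pcharK p_gt2 lin0_inj node_inj inv_H) ?eqxx // in lead_H.
by have /dhomogP hom := hom_H => m /hom /= ->.
Qed.

(** At x = 0, y = 1 the element [g] translates z by [2 lin 0 g]. These are [p^3] distinct values, so
    the restriction, of degree below [p^3], is constant; by homogeneity a monomial without x is
    known from its z-exponent. *)
Lemma inv_zdeg_lt_supp R d : inv R -> R \is d.-homog -> zdeg_lt (p ^ 3) R ->
  forall m, m \in msupp R -> m 0%R = 0%N -> m 2%:R = 0%N.
Proof.
move=> inv_R hom_R lt_R.
pose u := line_poly (tnth [tuple 0; 1; 'X]) R.
have uE : u = \sum_(m <- msupp R) (R@_m * (m 0%R == 0%N)%:R) *: 'X^(m 2%:R).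
  apply: eq_bigr => m _; rewrite /mmap1 big_I3 !(tnth_nth 0) /= expr1n mul1r.
  by rewrite expr0n mul_polyC; case: (_ == 0%N); rewrite ?(mulr1, mul1r, mulr0, mul0r, scaler0, scale0r).
have inj2 : injective (fun g : V => 2%:R * lin X 0 g).
  by move=> g1 g2 /(mulfI (two_neq0 pcharK p_gt2))/lin0_inj.
have const_u : u = (u.[0])%:P.
  apply: (const_on_injective_const inj2) => [|g].
    rewrite (card_V pcharK); apply/leq_sizeP => k le_k.
    rewrite uE coef_sum big1_seq // => m /andP[_ /lt_R lt_m].
    by rewrite coefZ coefXn (gtn_eqF (leq_trans lt_m le_k)) mulr0.
  rewrite !horner_line_poly -[R in RHS](inv_shear g inv_R) shear_meval.
  by apply: meval_eq; apply: forall_I3; rewrite !(tnth_nth 0) ![nth _ _ _]/=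
    !(hornerC, hornerX) ?(mulr0, mulr1, addr0, add0r).
move=> m supp_m m0; have /dhomogP/(_ m supp_m) /= deg_m := hom_R.
apply/eqP; apply: contraTT supp_m => nz_m2.
rewrite -mcoeff_eq0; have := congr1 (coefp (m 2%:R)) const_u.
rewrite /= coefC (negPf nz_m2) => <-; rewrite uE coef_sum {1}(mpolyE R) raddf_sum /=.
apply/eqP; apply: eq_big_seq => m' supp_m'; rewrite mcoeffZ mcoeffX coefZ coefXn.
rewrite -mulrA -natrM mulnb; congr (_ * _%:R); congr nat_of_bool.
have /dhomogP hom := hom_R.
apply/eqP/andP => [->|[/eqP e0 /eqP e2]]; first by rewrite m0 !eqxx.
have /= := hom _ supp_m'; move: deg_m; rewrite !mdeg3 -e2 e0 m0 => d1 d2.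
by apply: mnm3P; rewrite ?e0 ?m0 ?e2 //; lia.
Qed.

Lemma divXK_supp f : (forall m, m \in msupp f -> (0 < m 0%R)%N) ->
  f = x * divX 0 1 f.
Proof.
move=> gt0; rewrite {1}(mpolyE f) /divX mulr_sumr; apply: eq_big_seq => m /gt0 gt0_m.
rewrite -scalerAr -mpolyXD mulm1n addmC submK //.
by rewrite lep1mP -lt0n.
Qed.

Lemma lead_mon_invariant h : inv h -> h != 0 -> is_lead_exp (lead_mon h).
Proof.
have [n] := ubnP (mdeg (lead_mon h)); elim: n h => // n IHn h lt_n inv_h nz_h.
set L := lead_mon h in lt_n *; pose h0 := pihomog mdeg (mdeg L) h.
have inv_h0 : inv h0 by apply: inv_pihomog.
have hom_h0 : h0 \is (mdeg L).-homog by apply: pihomogP.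
have nz_hL : h@_L != 0 by rewrite mcoeff_lead_eq0.
have lead_h0 : has_lead h0 L h@_L.
  split; last by rewrite mcoeff_pihomog eqxx.
  move=> m; rewrite mcoeff_msupp mcoeff_pihomog => nz_m; apply: lead_mon_max.
  by rewrite mcoeff_msupp; apply: contraNneq nz_m => ->; rewrite mul0rn.
have lead_mon_h0 := lead_mon_has_lead nz_hL lead_h0.
have nz_h0 := has_lead_neq0 nz_hL lead_h0.
have /dhomogP deg_h0 := hom_h0.
have [L0|L0] := posnP (L 0); last first.
  (* Within one degree the lead monomial has the least x-exponent, so x divides all of [h0]. *)
  have gt0 m : m \in msupp h0 -> (0 < m 0%R)%N.
    move=> supp_m; have [le_L _] := lead_h0; have := le_L m supp_m.
    rewrite grevlex3; last exact: deg_h0.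
    by case/orP => [|/andP[/eqP->]] //; apply: leq_ltn_trans.
  have def_h0 := divXK_supp gt0; set h' := divX 0 1 h0 in def_h0.
  have nz_h' : h' != 0 by apply: contraNneq nz_h0 => h'0; rewrite def_h0 h'0 mulr0.
  have inv_h' : inv h'.
    apply: (@invMl _ _ _ _ x); [|exact: inv_x|by rewrite -def_h0].
    by rewrite -msupp_eq0 msuppX.
  have def_L : L = (U_(0%R) + lead_mon h')%MM.
    rewrite -lead_mon_h0 def_h0.
    apply: lead_mon_has_lead (has_leadM (has_leadXm _) (has_lead_lead_mon h')).
    by rewrite mul1r mcoeff_lead_eq0.
  rewrite def_L; apply: is_lead_expD; first by have := is_lead_exp_gen 0 1; rewrite mulm1n.
  by apply: IHn => //; move: lt_n; rewrite def_L mdegD mdeg1.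
have [L2|L2] := posnP (L 2%:R).
  have def_L : L = (U_(1) *+ mdeg L)%MM.
    by apply: mnm3P; rewrite mulmnE mnm1E ?L0 ?L2 //= mdeg3 L0 L2; lia.
  rewrite def_L; apply: (lead_mon_pow_y inv_h0) => //.
  by rewrite -def_L.
have lead_N := has_lead_normz pcharK p_gt2 lin0_inj.
have hom_N := homog_normz pcharK p_gt2 lin0_inj.
have inv_N := inv_normz pcharK p_gt2 lin0_inj.
have [Q [R [def_h0 hom_R lt_R]]] := monic_division lead_N hom_N hom_h0.
(* Comparing [h0] with its shear, the norm times [Q] minus its shear is a difference of remainders,
   of degree below [p^3] in z. *)
have inv_Q : inv Q.
  apply: shear_inv => g; apply/eqP; rewrite -subr_eq0; apply/eqP.
  apply: (monic_division_unique lead_N hom_N (R := R - shear (lin X 0 g) (lin X 1 g) R)).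
    exact: size_zpoly_sub_shear.
  have := inv_shear g inv_h0; rewrite {1}def_h0 shear_add shearM (inv_shear g inv_N).
  move: (shear _ _ Q) (shear _ _ R) => Q' R'; rewrite def_h0 => /eqP; rewrite -subr_eq0 => /eqP e.
  by apply/eqP; rewrite -subr_eq0; apply/eqP; rewrite -[RHS]e; ring.
have inv_R : inv R.
  have -> : R = h0 + (- 1) *: (Q * normz p X) by rewrite def_h0 scaleN1r addrC addKr.
  by apply: invD => //; apply/invZ/invM.
have /dhomogP deg_R := hom_R.
(* [L] contains z but not x, so by [inv_zdeg_lt_supp] it does not occur in [R]: the lead term comes
   from [Q * normz p X]. *)
have lead_R : has_lead R L 0.
  have supp_R := inv_zdeg_lt_supp inv_R hom_R lt_R.
  split=> [m supp_m|]; last first.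
    apply: memN_msupp_eq0; apply: contraTN L2 => /supp_R/(_ L0) ->.
    by rewrite ltnn.
  have := deg_R m supp_m => /= deg_m; rewrite grevlex3 // L0.
  have [m0|//] := posnP (m 0); have := supp_R m supp_m m0.
  by move: deg_m; rewrite !mdeg3 L0 m0 /=; lia.
have lead_QN : has_lead (Q * normz p X) L h@_L.
  have -> : Q * normz p X = h0 - R by rewrite def_h0 addrK.
  by rewrite -[h@_L]subr0; apply: has_leadD => //; apply: has_leadN.
have nz_Q : Q != 0.
  by apply: contraNneq (has_lead_neq0 nz_hL lead_QN) => ->; rewrite mul0r.
have def_L : L = (lead_mon Q + U_(2%:R) *+ (p ^ 3))%MM.
  rewrite -(lead_mon_has_lead nz_hL lead_QN).
  apply: lead_mon_has_lead (has_leadM (has_lead_lead_mon Q) lead_N).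
  by rewrite mulr1 mcoeff_lead_eq0.
rewrite def_L; apply: is_lead_expD; last by have := is_lead_exp_gen 4%:R 1; rewrite mulm1n.
apply: IHn => //; move: lt_n; rewrite def_L mdegD mdegMn mdeg1 mul1n ltnS.
by apply: leq_trans; rewrite -addn1 leq_add2l expn_gt0 (ltn_trans _ p_gt2).
Qed.


End LeadOfInvariants.

(** * The relations *)

Lemma big_I5 (R : Type) (idx : R) (op : Monoid.law idx) (F : 'I_5 -> R) :
  \big[op/idx]_(i < 5) F i
    = op (F 0) (op (F 1) (op (F 2%:R) (op (F 3%:R) (F 4%:R)))).
Proof.
rewrite !big_ord_recl big_ord0 Monoid.mulm1.
by congr (op _ (op (F _) (op (F _) (op (F _) (F _))))); apply: val_inj.
Qed.

Lemma lem_mulU n (i : 'I_n) k (m : 'X_{1..n}) : (U_(i) *+ k <= m)%MM = (k <= m i)%N.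
Proof.
apply/mnm_lepP/idP => [/(_ i)|le_k j]; rewrite mulmnE mnm1E.
  by rewrite eqxx mul1n.
by have [<-|] := eqVneq i j; rewrite ?mul1n.
Qed.

Section Relations.
Context {K : fieldType} (p : nat) (X : 'M[K]_(2, 3)).
Hypothesis pcharK : p \in [pchar K].
Hypothesis p_gt2 : (2 < p)%N.
Hypothesis gamma123_neq0 : gamma p X 1 2 3 != 0.
Hypothesis gamma135_neq0 : gamma p X 1 3 5 != 0.
Local Notation V := 'rV['F_p]_3.
Hypothesis lin0_inj : injective (lin (p := p) X 0).
Hypothesis node_inj : {in [pred g : V | g != 0] &, injective (node X)}.

Local Notation inv := (in_invariant_ring p X).
Local Notation B := (gens p X).
Local Notation g := (gamma p X 1 2 3).

Let B_neq0 := gens_neq0 pcharK p_gt2 gamma123_neq0 gamma135_neq0 lin0_inj.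

Let inv_B P : inv (P \mPo B) := inv_comp P (inv_gens pcharK p_gt2 lin0_inj).

Let lead_B := lead_mon_invariant pcharK p_gt2 gamma123_neq0 gamma135_neq0 lin0_inj node_inj.

Lemma sagbi_basis_gens : sagbi_basis B inv.
Proof. exact (sagbi_basisP B_neq0 inv_B lead_B). Qed.

Lemma subduction_gens P : exists Q, subduction_relation B P Q.
Proof. exact (subduction_exists B_neq0 inv_B lead_B P). Qed.

Lemma f3_relation : f3_num p X + 2%:R *: ('X_0 ^+ (p ^ 2 - 2) * f3 p X) = 0.
Proof. by rewrite (f3_numE X pcharK p_gt2) scaleNr addNr. Qed.

Lemma comp_rel2 : rel2 p X \mPo B = 0.
Proof.
rewrite -f3_relation /rel2 !(comp_mpolyD, comp_mpolyZ) !rmorphM !rmorphXn /=.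
by rewrite !comp_mpolyXU.
Qed.

Lemma lead_exp_gensE I : [/\ lead_exp B I 0 = I 0,
  lead_exp B I 1 = (2 * p * I 1%R + p ^ 2 * I 2%:R%R + (p ^ 2 + 2) * I 3%:R%R)%N
  & lead_exp B I 2%:R = (p ^ 3 * I 4%:R%R)%N].
Proof.
have E l : lead_exp B I l = (\sum_i tnth (gens_lead p) i l * I i)%N.
  rewrite /lead_exp mnm_sumE; apply: eq_bigr => i _.
  by rewrite mulmnE lead_mon_gens_tnth.
by rewrite !E !big_I5 !(tnth_nth 0%MM) /= !(mulmnE, mnm1E) /=; split; lia.
Qed.

(* Breaks the ties between X_3^p and X_1 X_2^p and between X_2^2 and X_1^p,
   whose values at the generators have the same leading monomial. *)
Definition degeneration_weight (I : 'X_{1..5}) : nat := (2 * I 3%:R%R + I 2%:R%R)%N.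
Local Notation wt := degeneration_weight.

Lemma degeneration_weightD I J : wt (I + J)%MM = (wt I + wt J)%N.
Proof. by rewrite /wt !mnmDE; lia. Qed.

Lemma lead_exp_gens_inj :
  {in [pred J | ~~ (U_(3%:R) *+ p <= J)%MM && ~~ (U_(2%:R) *+ 2 <= J)%MM] &,
   injective (lead_exp B)}.
Proof.
move=> I J; rewrite !inE !lem_mulU -!ltnNge => /andP[ltI3 ltI2] /andP[ltJ3 ltJ2] eqIJ.
have [I0 I1 I2] := lead_exp_gensE I; have [J0 J1 J2] := lead_exp_gensE J.
rewrite eqIJ {eqIJ} in I0 I1 I2.
have eq1 : (2 * p * I 1%R + p ^ 2 * I 2%:R%R + (p ^ 2 + 2) * I 3%:R%R
  = 2 * p * J 1%R + p ^ 2 * J 2%:R%R + (p ^ 2 + 2) * J 3%:R%R)%N by rewrite -I1 J1.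
have [e1 e2 e3] := semigroup_normal_form_unique (p_odd pcharK p_gt2) ltI2 ltJ2 ltI3 ltJ3 eq1.
apply/mnmP; apply: forall_I5 => //; first by rewrite -I0 J0.
apply/eqP; rewrite -(eqn_pmul2l (m := p ^ 3)) -?I2 -?J2 //.
by rewrite expn_gt0 (ltn_trans _ p_gt2).
Qed.

(** Both products have the same degree. As [I] has no factor x, such a factor in [J] makes its lead
    monomial strictly smaller; otherwise the lead monomials agree and the weight decides. *)
Lemma lower_gens (I J : 'X_{1..5}) : I 0 = 0%N -> I 4%:R = 0%N -> J 4%:R = 0%N ->
    (J 0%R + (2 * p * J 1%R + p ^ 2 * J 2%:R%R + (p ^ 2 + 2) * J 3%:R%R)
     = 2 * p * I 1%R + p ^ 2 * I 2%:R%R + (p ^ 2 + 2) * I 3%:R%R)%N ->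
    (0 < J 0%R)%N || (wt J < wt I)%N ->
  lower B wt J I.
Proof.
move=> zI0 zI4 zJ4 eq_D gt0; have [I0 I1 I2] := lead_exp_gensE I.
have [J0 J1 J2] := lead_exp_gensE J; rewrite zI4 muln0 in I2.
rewrite zJ4 muln0 in J2; rewrite zI0 in I0; rewrite -J1 -I1 in eq_D.
have eq_deg : mdeg (lead_exp B J) = mdeg (lead_exp B I).
  by rewrite !mdeg3 I0 I2 J0 J2 -eq_D; lia.
rewrite /lower grevlex3 // I0 J0; have [J_0|J0_gt0] := posnP (J 0%R).
  move: gt0 eq_D; rewrite J_0 add0n /= => -> ->; rewrite leqnn orbT.
  by [].
rewrite /=; apply/orP; left; apply: contraTneq J0_gt0 => eq_IJ.
by rewrite -J0 eq_IJ I0.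
Qed.

Lemma mnm_neq n i (m1 m2 : 'X_{1..n}) : m1 i != m2 i -> (m1 == m2) = false.
Proof. by move=> ne_i; apply: contraNF ne_i => /eqP->. Qed.

(** [X_1^p] ties with [X_2^2] but has smaller weight; the other two monomials contain [X_0]. *)
Lemma rel2_rewrites : rewrites_to_lower B wt (rel2 p X) (U_(2%:R) *+ 2).
Proof.
rewrite /rewrites_to_lower /rel2 !mpolyXn -!mpolyXD; split.
  rewrite !(mcoeffD, mcoeffZ) !mcoeffX eqxx.
  rewrite !(@mnm_neq _ 2%:R _ (U_(2%:R) *+ 2)%MM) ?(mulmnE, mnmDE, mnm1E) //.
  by rewrite !mulr0 add0r !addr0 mulr1 expf_neq0.
have lt_p2 := double_lt_sqr p_gt2; have half := half_p1 (p_odd pcharK p_gt2).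
move=> J supp_J ne_J.
have : J \in [:: (U_(1) *+ p)%MM; (U_(0%R) *+ (p ^ 2 - p) + U_(1) *+ (p + 1)./2)%MM;
                 (U_(0%R) *+ (p ^ 2 - 2) + U_(3%:R))%MM].
  have supp1 m : J \in msupp ('X_[m] : {mpoly K[5]}) -> J = m.
    by rewrite msuppX inE => /eqP.
  rewrite !inE; move/msuppD_le: supp_J; rewrite mem_cat => /orP[|/msuppZ_le/supp1->]; last by rewrite eqxx !orbT.
  move/msuppD_le; rewrite mem_cat => /orP[|/msuppZ_le/supp1->]; last by rewrite eqxx !orbT.
  move/msuppD_le; rewrite mem_cat => /orP[/supp1->|/msuppZ_le/supp1 eq_J]; first by rewrite eqxx.
  by rewrite eq_J eqxx in ne_J.
rewrite !inE => /or3P[]/eqP->; apply: lower_gens;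
  rewrite /wt ?(mnmDE, mulmnE, mnm1E) /= ?(mul0n, mul1n, muln0, addn0, add0n, muln1) //; try nia.
Qed.

(** Both terms lead with [y^(p^3 + 2p)]; the scalar in [subduct_input] makes their coefficients
    opposite, namely [gamma_135^p g^(p^2 - p)] up to sign. *)
Lemma rel1_lead_cancels : has_lead (subduct_input p X \mPo B) (lead_exp B (U_(3%:R) *+ p)) 0.
Proof.
have lead := has_lead_gens_tnth pcharK p_gt2 lin0_inj.
have lt_p2 := double_lt_sqr p_gt2.
have [_ B1 B2 B3 _] := tnth_gens p X.
have -> : subduct_input p X \mPo B
    = f3 p X ^+ p + (gamma p X 1 3 5 ^+ p * g ^+ (p ^ 2 - 2 * p - 1))
                      *: (f1 p X * f2 p X ^+ p).
  rewrite /subduct_input comp_mpolyD comp_mpolyZ rmorphM !rmorphXn /=.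
  by rewrite !comp_mpolyXU.
have lead3 := has_leadX p (lead 3%:R); rewrite B3 in lead3.
have lead12 := has_leadM (lead 1) (has_leadX p (lead 2%:R)); rewrite B1 B2 in lead12.
rewrite lead_expMn lead_exp1 // lead_mon_gens_tnth //.
have eq_m : (tnth (gens_lead p) 1 + tnth (gens_lead p) 2%:R *+ p
             = tnth (gens_lead p) 3%:R *+ p)%MM.
  by apply/mnmP => l; rewrite !(tnth_nth 0%MM) /= !(mnmDE, mulmnE); lia.
rewrite eq_m in lead12.
have := has_leadD lead3 (has_leadZ (gamma p X 1 3 5 ^+ p * g ^+ (p ^ 2 - 2 * p - 1)) lead12).
rewrite [X in has_lead _ _ X](_ : _ = 0) // !(tnth_nth 0) /= exprMn -exprM.
have -> : ((p - 1) * p = (p ^ 2 - 2 * p - 1) + 1 + p)%N by nia.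
by rewrite !exprD; ring.
Qed.

(** No explicit form of [Q] is needed: by the cancellation, every term added by subduction leads
    strictly below [X_3^p], and [X_1 X_2^p] ties with it but has weight [p] against [2p]. *)
Lemma rel1_rewrites Q : subduction_relation B (subduct_input p X) Q ->
  rewrites_to_lower B wt Q (U_(3%:R) *+ p).
Proof.
move=> [sub_Q _]; set P := subduct_input p X in sub_Q; set M := (U_(3%:R) *+ p)%MM.
have lt_sub J : J \in msupp (P - Q) ->
    grevlex (lead_exp B J) (lead_exp B M) /\ lead_exp B J != lead_exp B M.
  move=> /(subducts_supp B_neq0 sub_Q)[nz_P le_J].
  have [le_P ne_P] := lead_mon_lt rel1_lead_cancels nz_P.
  split; first exact: grevlex_trans le_J le_P.
  apply: contraNneq ne_P => eq_J; apply/eqP/grevlex_anti; rewrite le_P -eq_J /=.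
  exact: le_J.
have PE : P = 'X_[M] + (gamma p X 1 3 5 ^+ p * g ^+ (p ^ 2 - 2 * p - 1))
                *: 'X_[U_(1) + U_(2%:R) *+ p].
  by rewrite /P /subduct_input !mpolyXn -mpolyXD.
have PM : P@_M = 1.
  rewrite PE mcoeffD mcoeffZ !mcoeffX eqxx (@mnm_neq _ 1) ?mulr0 ?addr0 //.
  by rewrite !(mnmDE, mulmnE, mnm1E).
have QM : Q@_M = 1.
  rewrite -PM; apply/eqP; rewrite eq_sym -subr_eq0 -mcoeffB.
  by rewrite mcoeff_eq0; apply/negP => /lt_sub[_]; rewrite eqxx.
split=> [|J supp_J ne_J]; first by rewrite QM oner_eq0.
have [/lt_sub[le_J ne_lead]|nsupp_J] := boolP (J \in msupp (P - Q)).
  by rewrite /lower le_J ne_lead.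
have supp_P : J \in msupp P.
  move: supp_J nsupp_J; rewrite -mcoeff_eq0 !mcoeff_msupp mcoeffB subr_eq0.
  by move=> nz_Q /eqP->.
move: supp_P; rewrite PE => /msuppD_le; rewrite mem_cat msuppX inE (negPf ne_J) /=.
move/msuppZ_le; rewrite msuppX inE => /eqP->; apply: lower_gens;
  rewrite /wt ?(mnmDE, mulmnE, mnm1E) /= ?(mul0n, mul1n, muln0, addn0, add0n, muln1) //; try nia.
Qed.

(** Subduction may involve choices, so the result is for every relation that it can construct. *)
Lemma relations_gens Q : subduction_relation B (subduct_input p X) Q ->
  relations_generated_by B Q (rel2 p X).
Proof.
move=> sub_Q; apply: (relations_generated_byP B_neq0 degeneration_weightD
  (rel1_rewrites sub_Q) rel2_rewrites (proj2 sub_Q) comp_rel2 lead_exp_gens_inj).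
Qed.

End Relations.

(** * The generic matrix *)

Lemma node_cross_mul (F : fieldType) (a b a' b' : F) :
    2%:R != 0 :> F -> a != 0 -> a' != 0 ->
    - (a ^+ 2 + b) / (2%:R * a) = - (a' ^+ 2 + b') / (2%:R * a') ->
  (a ^+ 2 + b) * a' = (a' ^+ 2 + b') * a.
Proof.
move=> nz2 nz_a nz_a' eq_node.
have -> : (a ^+ 2 + b) * a' = - (a ^+ 2 + b) / (2%:R * a) * - (2%:R * a * a').
  by field; rewrite nz_a.
by rewrite eq_node; field; rewrite nz_a'.
Qed.

Lemma sqr_mul_swap (R : idomainType) (u v : R) :
  u != 0 -> v != 0 -> u ^+ 2 * v = v ^+ 2 * u -> u = v.
Proof.
move=> nz_u nz_v eq_uv; apply: (mulfI nz_u); apply: (mulfI nz_v).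
have -> : v * (u * u) = u ^+ 2 * v by ring.
by rewrite eq_uv; ring.
Qed.

Section Generic.
Context (p : nat).
Hypothesis p_pr : prime p.
Hypothesis p_gt2 : (2 < p)%N.
Local Notation P := {mpoly 'F_p[2 * 3]}.
Local Notation X := (genX p).
Local Notation V := 'rV['F_p]_3.

Lemma genXE r c : X r c = tofrac ('X_(mxvec_index r c) : P).
Proof. by rewrite mxE. Qed.

(** The form [lin] before passing to fractions, where coefficients can be compared. *)
Definition gen_lin (r : 'I_2) (g : V) : P := \sum_i 'X_(mxvec_index r i) *+ g 0 i.

Lemma lin_genX r g : lin X r g = tofrac (gen_lin r g).
Proof.
rewrite /lin /gen_lin raddf_sum; apply: eq_bigr => i _.
by rewrite raddfMn genXE.
Qed.

Lemma mxvec_index_inj r r' c c' :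
  (mxvec_index r c == mxvec_index r' c' :> 'I_(2 * 3)) = ((r, c) == (r', c')).
Proof. by rewrite /mxvec_index (inj_eq (@cast_ord_inj _ _ _)) (inj_eq enum_rank_inj). Qed.

Lemma gen_lin_inj r : injective (gen_lin r).
Proof.
move=> g h eq_gh; apply/rowP => i.
have coefE g' : (gen_lin r g')@_U_(mxvec_index r i) = g' 0 i.
  rewrite raddf_sum (bigD1 i) //= big1 => [|j ne_j].
    by rewrite addr0 mcoeffMn mcoeffXU eqxx natr_Zp.
  by rewrite mcoeffMn mcoeffXU mxvec_index_inj xpair_eqE eqxx (negPf ne_j) mul0rn.
by rewrite -!coefE eq_gh.
Qed.

Lemma lin0_genX_inj : injective (lin (p := p) X 0).
Proof. by move=> g h; rewrite !lin_genX => /eqP; rewrite tofrac_eq => /eqP/gen_lin_inj. Qed.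

Lemma node_genX_inj : {in [pred g : V | g != 0] &, injective (node X)}.
Proof.
have pcharK := pchar_genK p_pr.
move=> g h /(lin0_neq0 lin0_genX_inj) nz_g /(lin0_neq0 lin0_genX_inj) nz_h.
have nz2 := two_neq0 pcharK p_gt2.
move=> eq_node; have := node_cross_mul nz2 nz_g nz_h eq_node.
rewrite !lin_genX -!rmorphXn -!rmorphD -!rmorphM => /eqP; rewrite tofrac_eq => /eqP eq_gen.
(* Setting the second row of indeterminates to 0 separates the two nodes. *)
pose th : P -> P := comp_mpoly
  [tuple if [exists i, k == mxvec_index 0 i] then 'X_k else 0 | k < 2 * 3].
have thX r c : th 'X_(mxvec_index r c) = 'X_(mxvec_index r c) *+ (r == 0).
  rewrite /th comp_mpolyXU -tnth_nth tnth_mktuple.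
  case: existsP => [[c' ]|nex].
    by rewrite mxvec_index_inj xpair_eqE => /andP[/eqP-> _]; rewrite eqxx.
  have [r0|//] := eqVneq r 0; case: nex; exists c; by rewrite r0.
have th_lin r g' : th (gen_lin r g') = gen_lin r g' *+ (r == 0).
  rewrite /gen_lin /th raddf_sum -sumrMnl; apply: eq_bigr => i _.
  by rewrite mulrnAC -thX; apply: raddfMn.
move/(congr1 th): eq_gen; rewrite /th !(rmorphM, rmorphD, rmorphXn) /= -/th !th_lin !addr0.
rewrite !mulr1n => eq_lin; apply: (@gen_lin_inj 0).
have nz (g' : V) : lin X 0 g' != 0 -> gen_lin 0 g' != 0.
  by rewrite lin_genX tofrac_eq0.
exact: sqr_mul_swap (nz _ nz_g) (nz _ nz_h) eq_lin.
Qed.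

Lemma Xn_sub_neq0 (F : fieldType) m n : m != n -> 'X^m - 'X^n != 0 :> {poly F}.
Proof.
move=> ne_mn; apply/eqP => /(congr1 (coefp m)) /=.
rewrite coefB !coefXn eqxx (negPf ne_mn) subr0 coef0 => /eqP.
by rewrite oner_eq0.
Qed.

(** Specialising the indeterminates to the entries of [M] is a ring morphism, so one specialisation
    with nonzero determinant suffices. *)
Lemma genX_det3_neq0 (r1 r2 r3 : 'I_2) (n1 n2 n3 : nat) (M : 'M[{poly 'F_p}]_(2, 3)) :
  det3 (fun c => M r1 c ^+ n1) (fun c => M r2 c ^+ n2) (fun c => M r3 c ^+ n3) != 0 ->
  det3 (fun c => X r1 c ^+ n1) (fun c => X r2 c ^+ n2) (fun c => X r3 c ^+ n3) != 0.
Proof.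
pose Y r n (c : 'I_3) : P := 'X_(mxvec_index r c) ^+ n.
have defM : det3 (fun c => M r1 c ^+ n1) (fun c => M r2 c ^+ n2) (fun c => M r3 c ^+ n3)
  = mmap polyC (mxvec M 0) (det3 (Y r1 n1) (Y r2 n2) (Y r3 n3)).
  rewrite rmorph_det3; apply: eq_det3 => c;
  by rewrite /Y /= rmorphXn /= mmapX mmap1U mxvecE.
have defX : det3 (fun c => X r1 c ^+ n1) (fun c => X r2 c ^+ n2) (fun c => X r3 c ^+ n3)
  = tofrac (det3 (Y r1 n1) (Y r2 n2) (Y r3 n3)).
  rewrite rmorph_det3; apply: eq_det3 => c;
  by rewrite /Y /= rmorphXn genXE.
by rewrite defM defX tofrac_eq0; apply: contra_neq => ->; rewrite mmap0.
Qed.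

Lemma gamma123_genX_neq0 : gamma p X 1 2 3 != 0.
Proof.
rewrite gammaE // (eq_det3 (gamma_row1 _ _) (gamma_row2 _ _) (gamma_row3 _ _)).
(* The rows (1, X, 0) and (0, 0, 1) give the determinant [X - X^p]. *)
apply: (@genX_det3_neq0 0 1 0 1 1 p (\matrix_(r, c) if r == 0 then
  (if c == 0 then 1 else if c == 1 then 'X else 0) else (c == 2%:R)%:R)).
rewrite /det3 !mxE /= (_ : _ + _ = 'X^1 - 'X^p).
  by apply: Xn_sub_neq0; rewrite ltn_eqF // ltnW.
by rewrite !expr1 expr1n !(mul0r, mul1r, mulr1, mulr0); ring.
Qed.

Lemma gamma135_genX_neq0 : gamma p X 1 3 5 != 0.
Proof.
rewrite gammaE // (eq_det3 (gamma_row1 _ _) (gamma_row3 _ _) (gamma_row5 _ _)).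
(* With first row (1, X, X^2) the minor is the Vandermonde determinant of [X], [X^p], [X^(p^2)]. *)
apply: (@genX_det3_neq0 0 0 0 1 p (p ^ 2) (\matrix_(r, c) 'X ^+ c)).
have p_gt1 : (1 < p)%N by apply: ltnW.
have lt_p : (p < p ^ 2)%N by rewrite -mulnn ltn_Pmull // ltnW.
rewrite /det3 !mxE /= (_ : _ + _ = ('X^p - 'X^1) * ('X^(p ^ 2) - 'X^1) * ('X^(p ^ 2) - 'X^p)).
  by rewrite !mulf_neq0 ?Xn_sub_neq0 // gtn_eqF // (ltn_trans p_gt1).
by rewrite ![('X^2) ^+ _]exprAC !expr0 !expr1 !expr1n; ring.
Qed.

End Generic.

Theorem theorem8p4 (p : nat) (hp : prime p) (hp2 : (2 < p)%N) :
  let X := genX p in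
  let B := gens p X in
  let gamma := gamma p X in
  [/\ sagbi_basis B (in_invariant_ring p X),
      exists rel1, subduction_relation B (subduct_input p X) rel1,
      forall rel1, subduction_relation B (subduct_input p X) rel1 ->
        relations_generated_by B rel1 (rel2 p X)
    & f1 p X ^+ p + gamma 1%N 2%N 3%N ^+ (p - 2) *: f2 p X ^+ 2
      + (2%:R * (- gamma 1%N 2%N 3%N) ^+ (p - 3)./2 * gamma 1%N 2%N 5%N)
          *: ('X_0 ^+ (p ^ 2 - p) * f1 p X ^+ (p + 1)./2)
      + 2%:R *: ('X_0 ^+ (p ^ 2 - 2) * f3 p X) = 0].
Proof.
have pcharK := pchar_genK hp.
have inj0 := @lin0_genX_inj p.
have inj_node := node_genX_inj hp hp2.
have nz123 := gamma123_genX_neq0 hp2.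
have nz135 := gamma135_genX_neq0 hp2.
move=> X B gamma; split.
- exact (sagbi_basis_gens pcharK hp2 nz123 nz135 inj0 inj_node).
- exact (subduction_gens pcharK hp2 nz123 nz135 inj0 inj_node _).
- exact (relations_gens pcharK hp2 nz123 nz135 inj0).
- exact (f3_relation X pcharK hp2).
Qed.
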